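(* Let $p\colon V\to M$ be a real vector bundle. If $\varphi,\psi\colon M\to M$ are two $C^{0}$ homotopic diffeomorphisms, then $\varphi$ can be lifted to an automorphism of $V$ if and only if $\psi$ can. Hence, if every diffeomorphism of $M$ is homotopic to a diffeomorphism of $M$ that can be lifted to an automorphism of $V$, then $h_V\colon\mathrm{AUT}\,V\to\mathrm{Diff}\,M$ is surjective.
   Context: All manifolds are connected, second countable, $C^\infty$, without boundary and finite-dimensional; all bundles are $C^\infty$. For a real vector bundle $p\colon V\to M$, $\mathrm{AUT}\,V$ is the group of automorphisms of $V$, i.e. diffeomorphisms $\Phi\colon V\to V$ mapping each fibre $V_x$ onto a fibre $V_{x'}$ by an $\mathbb{R}$-linear isomorphism, and $h_V\colon\mathrm{AUT}\,V\to\mathrm{Diff}\,M$ is the homomorphism sending $\Phi$ to the diffeomorphism $x\mapsto x'$ it induces on the base. A diffeomorphism $\varphi$ of $M$ can be lifted to an automorphism of $V$ if $\varphi=h_V(\Phi)$ for some $\Phi\in\mathrm{AUT}\,V$. Homotopies are through continuous maps $M\to M$ (not necessarily diffeomorphisms). *)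

(* Defs.v *)
From HB Require Import structures.
From mathcomp Require Import all_boot all_order all_algebra.
From mathcomp Require Import all_classical all_reals all_analysis.

Set Implicit Arguments.
Unset Strict Implicit.
Unset Printing Implicit Defensive.

Import Order.TTheory GRing.Theory Num.Theory.
Import numFieldNormedType.Exports.

Local Open Scope classical_set_scope.
Local Open Scope ring_scope.

(** [Ck k A f]: [f] is of class C^k on the set [A], which is open wherever this
    is used.  [E] and [F] are meant to be finite-dimensional: there the map
    [x |-> 'd f x] into the linear maps is C^k as soon as [x |-> 'd f x v] is,
    for every vector [v]. *)
Fixpoint Ck (R : realType) (E F : normedModType R) (k : nat) (A : set E)
    (f : E -> F) : Prop :=
  if k is k'.+1 then
    (forall x, A x -> differentiable f x) /\
    (forall v : E, Ck k' A (fun x => 'd f x v))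
  else forall x, A x -> {for x, continuous f}.

Definition Cinfty (R : realType) (E F : normedModType R) (A : set E)
  (f : E -> F) : Prop := forall k, Ck k A f.

(** [chart_map] and [chart_inv] are total functions that are only meaningful on
    [chart_dom] and [chart_cod] respectively. *)
Record chart (T : topologicalType) (R : realType) (E : normedModType R) :=
  Chart {
    chart_dom : set T;
    chart_cod : set E;
    chart_map : T -> E;
    chart_inv : E -> T }.

Definition is_chart (T : topologicalType) (R : realType) (E : normedModType R)
    (c : chart T E) : Prop :=
  [/\ open (chart_dom c) /\ open (chart_cod c),
      (forall x, chart_dom c x -> chart_cod c (chart_map c x)) /\
      (forall y, chart_cod c y -> chart_dom c (chart_inv c y)),
      (forall x, chart_dom c x -> chart_inv c (chart_map c x) = x) /\
      (forall y, chart_cod c y -> chart_map c (chart_inv c y) = y)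
    & (forall x, chart_dom c x -> {for x, continuous (chart_map c)}) /\
      (forall y, chart_cod c y -> {for y, continuous (chart_inv c)})].

(** A space with a family of charts; the axioms of an atlas are in [manifold]. *)
Record charted (R : realType) (E : normedModType R) := Charted {
  charted_space :> topologicalType;
  atlas : set (chart charted_space E) }.

Definition model_charted (R : realType) (E : normedModType R) : charted E :=
  @Charted R E E [set Chart setT setT id id].

Definition prod_chart (S T : topologicalType) (R : realType)
    (E F : normedModType R) (c : chart S E) (d : chart T F) :
    chart (S * T)%type (E * F)%type :=
  @Chart (S * T)%type R (E * F)%type
    (chart_dom c `*` chart_dom d) (chart_cod c `*` chart_cod d)
    (fun z => (chart_map c z.1, chart_map d z.2))
    (fun w => (chart_inv c w.1, chart_inv d w.2)).

Definition prod_charted (R : realType) (E F : normedModType R)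
    (M : charted E) (N : charted F) : charted (E * F)%type :=
  @Charted R (E * F)%type (M * N)%type
    [set e | exists c d, [/\ atlas c, atlas d & e = prod_chart c d]].

(** [U] is open wherever this is used. *)
Definition smooth_on (R : realType) (E F : normedModType R)
    (M : charted E) (N : charted F) (U : set M) (f : M -> N) : Prop :=
  (forall x, U x -> {for x, continuous f}) /\
  (forall c d, atlas c -> atlas d ->
    Cinfty [set y | [/\ chart_cod c y, U (chart_inv c y)
                      & chart_dom d (f (chart_inv c y))]]
           (chart_map d \o f \o chart_inv c)).

Definition euclidean (R : realType) (n : nat) : normedModType R := 'rV[R]_n.

(** Connected, second countable, Hausdorff, without boundary, of dimension
    [mfd_dim].  The atlas need not be maximal: the smooth structure is the one
    it generates. *)
Record manifold (R : realType) := Manifold {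
  mfd_dim : nat;
  mfd_charted :> charted (euclidean R mfd_dim);
  mfd_chartP : forall c, @atlas _ _ mfd_charted c -> is_chart c;
  mfd_cover : forall x : mfd_charted, exists2 c, atlas c & chart_dom c x;
  mfd_compat : forall c d, @atlas _ _ mfd_charted c -> @atlas _ _ mfd_charted d ->
    Cinfty [set y | chart_cod c y /\ chart_dom d (chart_inv c y)]
           (chart_map d \o chart_inv c);
  mfd_hausdorff : hausdorff_space mfd_charted;
  mfd_second_countable : @second_countable mfd_charted;
  mfd_connected : connected [set: mfd_charted] }.

Definition smooth (R : realType) (M N : manifold R) (f : M -> N) : Prop :=
  smooth_on setT f.

Definition diffeomorphism (R : realType) (M N : manifold R) (f : M -> N) : Prop :=
  exists g : N -> M, [/\ cancel f g, cancel g f, smooth f & smooth g].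

Definition Diff (R : realType) (M : manifold R) : set (M -> M) :=
  [set f | diffeomorphism f].
Arguments Diff {R} M.

Definition trivial_bundle (R : realType) (M : manifold R) (r : nat) :=
  prod_charted M (model_charted (euclidean R r)).

(** Smooth real vector bundles.  The fibre over [x] is the real vector space
    [fibre x], identified by [fibre_incl x] with the subset
    [bundle_proj @^-1` [set x]] of the total space.  The rank is constant because
    the base is connected. *)
Record vector_bundle (R : realType) (M : manifold R) := VectorBundle {
  total_space :> manifold R;
  bundle_proj : total_space -> M;
  fibre : M -> lmodType R;
  fibre_incl : forall x : M, fibre x -> total_space;
  bundle_rank : nat;
  bundle_proj_smooth : smooth bundle_proj;
  fibre_incl_inj : forall x, injective (@fibre_incl x);
  fibre_incl_range : forall x, range (@fibre_incl x) = bundle_proj @^-1` [set x];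
  (* [t] is a diffeomorphism from the preimage of [U] onto U x R^bundle_rank,
     over [U] and linear on the fibres, with inverse [s] *)
  local_triviality : forall x : M, exists U : set M,
    exists t : total_space -> trivial_bundle M bundle_rank,
    exists s : trivial_bundle M bundle_rank -> total_space,
    [/\ open U /\ U x,
        smooth_on (bundle_proj @^-1` U) t /\
        smooth_on [set w : trivial_bundle M bundle_rank | U w.1] s,
        (forall v, U (bundle_proj v) -> (t v).1 = bundle_proj v /\ s (t v) = v),
        (forall w, U w.1 -> bundle_proj (s w) = w.1 /\ t (s w) = w)
      & forall y, U y -> linear (fun u : fibre y => (t (fibre_incl u)).2)] }.

Definition AUT (R : realType) (M : manifold R) (V : vector_bundle M) :
    set (V -> V) :=
  [set Phi | diffeomorphism Phi /\
    forall x : M, exists x' : M, exists2 L : {linear fibre V x -> fibre V x'},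
      bijective L & forall u, Phi (fibre_incl u) = fibre_incl (L u)].
Arguments AUT {R M} V.

(** The map of the base induced by [Phi]; for [Phi] in [AUT V], the zero vector
    could be replaced by any other vector of the fibre over [x]. *)
Definition hV (R : realType) (M : manifold R) (V : vector_bundle M)
    (Phi : V -> V) : M -> M :=
  fun x => bundle_proj (Phi (fibre_incl (0 : fibre V x))).
Arguments hV {R M} V Phi.

Definition liftable (R : realType) (M : manifold R) (V : vector_bundle M)
    (phi : M -> M) : Prop :=
  exists2 Phi, AUT V Phi & hV V Phi = phi.

Definition homotopic (R : realType) (M : manifold R) (f g : M -> M) : Prop :=
  exists H : M * R -> M,
    [/\ {within setT `*` `[0, 1], continuous H},
        forall x, H (x, 0) = f x & forall x, H (x, 1) = g x].

(* Main.v *)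
Require Import Defs.
From HB Require Import structures.
From mathcomp Require Import all_boot all_order all_algebra.
From mathcomp Require Import all_classical all_reals all_analysis.
From mathcomp Require Import ring lra.

(** By symmetry it suffices to lift [psi] when [phi] has a lift [Phi].  Smooth
    fibrewise linear functionals [lam_j] on [V] and smooth sections [e_j], locally
    finite and with [\sum_j lam_j(v) e_j(pr v) = v], give for all [x] and [y] a
    linear map [T_y : V_x -> V_y, v |-> \sum_j lam_j(v) e_j(y)], which is
    injective for [(x, y)] near the diagonal.  Composing [Phi] with these maps
    along the paths [t |-> H(x, t)] of the homotopy, in steps of a length that
    depends continuously on [x], yields a continuous fibrewise injective [A] over
    [psi].  The maps [v |-> T_(psi (pr v)) (A (T_z v))], where [z] is fixed, are
    smooth and close to [A] over a neighbourhood of [z]; averaging them with a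
    smooth partition yields a smooth fibrewise injective map over [psi].  As the
    fibres have the same dimension, it is an automorphism. *)

Set Implicit Arguments.
Unset Strict Implicit.
Unset Printing Implicit Defensive.

Import Order.TTheory GRing.Theory Num.Theory.
Import numFieldNormedType.Exports.

Local Open Scope classical_set_scope.
Local Open Scope ring_scope.

(** * Calculus of maps of class C^k *)

(** The maps T_y replace it: they join any two fibres, depend continuously on all data, and are the
    identity on the diagonal, so that their injectivity near it is an open condition. Since M need
    not be compact, no uniform step length exists. With a variable one the number of steps varies
    too, but once time 1 is reached every further step is an identity, so the result is locally one
    fixed finite composition. The lift so obtained is merely continuous. Freezing z repairs this,
    because T_z v stays in one fibre, and there A is linear. *)

Section Ck_calculus.
Context {R : realType}.
Implicit Types (E F G : normedModType R).

Lemma is_diff0 E F (f : E -> F) x :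
  (forall e : R, 0 < e -> \forall h \near (0 : E), `|f (h + x) - f x| <= e * `|h|) ->
  is_diff x f 0.
Proof.
move=> fo; pose z : {linear E -> F} := \0.
have eqo : f \o shift x = cst (f x) + z +o_ 0 id.
  apply/eqaddoE/eqaddoP => e e0; apply: filterS (fo _ e0) => h.
  by rewrite /= !fctE /= addr0.
have c0 : continuous z by move=> y; exact: cst_continuous.
have dE := diff_unique c0 eqo.
apply: DiffDef; last exact: dE.
by apply/diff_locallyP; rewrite dE.
Qed.

(** The difference [g - f] vanishes near [x], so its differential there is 0. *)
Lemma is_diff_near E F (f g df : E -> F) x :
  {near x, f =1 g} -> is_diff x f df -> is_diff x g df.
Proof.
move=> fg dfx.
have d0 : is_diff x (g - f) 0.
  apply: is_diff0 => e e0; have : \forall y \near x, f y = g y by [].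
  rewrite (near_shift 0) subr0 => fg0; apply: filterS fg0 => h /= fgh.
  by rewrite !fctE fgh (nbhs_singleton fg) !subrr normr0 mulr_ge0// ltW.
have -> : g = f + (g - f) by rewrite addrC subrK.
by rewrite -[df]addr0; exact: is_diffD.
Qed.

Lemma Ck_sub E F k (A B : set E) (f : E -> F) :
  A `<=` B -> Ck k B f -> Ck k A f.
Proof.
move=> AB; elim: k f => [|k IH] f /=; first by move=> h x /AB; exact: h.
by move=> [h1 h2]; split=> [x /AB|v]; [exact: h1|exact: IH].
Qed.

Lemma CkW E F k (A : set E) (f : E -> F) : Ck k.+1 A f -> Ck k A f.
Proof.
elim: k f => [|k IH] f.
  by move=> [h _] x Ax; exact/differentiable_continuous/h.
by move=> [h1 h2]; split=> // v; exact: IH.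
Qed.

(** [Ck k A f] only collects conditions at single points of [A]; the sets [B] therefore need not lie
    in [A]. *)
Lemma Ck_local E F k (A : set E) (f : E -> F) :
  (forall x, A x -> exists2 B, B x & Ck k B f) -> Ck k A f.
Proof.
elim: k f => [|k IH] f h /=.
  by move=> x /h[B Bx]; exact.
split=> [x /h[B Bx [hB _]]|v]; first exact: hB.
by apply: IH => x /h[B Bx [_ hB]]; exists B; [exact: Bx|exact: hB].
Qed.

Lemma Ck_ext E F k (A : set E) (f g : E -> F) :
  open A -> {in A, f =1 g} -> Ck k A f -> Ck k A g.
Proof.
move=> oA; elim: k f g => [|k IH] f g fg.
  move=> h x Ax; have fgx : {near x, g =1 f}.
    by apply: filterS (open_nbhs_nbhs (conj oA Ax)) => y Ay; rewrite fg ?inE.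
  have hx : f y @[y --> x] --> g x by rewrite -fg ?inE//; exact: h.
  apply: cvg_trans hx; apply: near_eq_cvg.
  by apply: filterS fgx => y ->.
move=> [h1 h2].
have dgE x : A x -> is_diff x g ('d f x).
  move=> Ax; apply: (@is_diff_near _ _ f); last exact/differentiableP/h1.
  by apply: filterS (open_nbhs_nbhs (conj oA Ax)) => y Ay; rewrite fg ?inE.
split=> [x /dgE []//|v]; apply: IH (h2 v) => x /[!inE] /dgE[_ /= ->]//.
Qed.

Lemma Ck_cst E F k (A : set E) (a : F) : Ck k A (cst a : E -> F).
Proof.
elim: k a => [|k IH] a; first by move=> x _; exact: cst_continuous.
split=> [x _|v]; first exact: differentiable_cst.
rewrite (_ : (fun x => 'd (cst a) x v) = cst 0); first exact: IH.
by apply/funext => x; rewrite diff_cst.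
Qed.

Lemma Ck_lin_comp E F G k (A : set E) (l : {linear F -> G}) (f : E -> F) :
  open A -> continuous l -> Ck k A f -> Ck k A (l \o f).
Proof.
move=> oA lc; elim: k f => [|k IH] f.
  by move=> h x Ax; apply: continuous_comp; [exact: h|exact: lc].
move=> [h1 h2]; split=> [x Ax|v].
  apply: (@differentiable_comp _ _ _ _ f l); first exact: h1.
  exact: linear_differentiable.
apply: (Ck_ext oA _ (IH _ (h2 v))) => x /[!inE] Ax /=.
rewrite (@diff_comp _ _ _ _ f l); [|exact: h1|exact: linear_differentiable].
by rewrite /= diff_lin.
Qed.

Lemma CkD E F k (A : set E) (f g : E -> F) :
  open A -> Ck k A f -> Ck k A g -> Ck k A (fun x => f x + g x).
Proof.
move=> oA; elim: k f g => [|k IH] f g.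
  by move=> hf hg x Ax; apply: continuousD; [exact: hf|exact: hg].
move=> [hf1 hf2] [hg1 hg2]; split=> [x Ax|v].
  by apply: differentiableD; [exact: hf1|exact: hg1].
apply: (Ck_ext oA _ (IH _ _ (hf2 v) (hg2 v))) => x /[!inE] Ax /=.
by rewrite (@diffD _ _ _ f g)//; [exact: hf1|exact: hg1].
Qed.

Lemma Ck_sum E F k (A : set E) (I : Type) (s : seq I) (P : pred I)
    (f : I -> E -> F) : open A ->
  (forall i, P i -> Ck k A (f i)) -> Ck k A (fun x => \sum_(i <- s | P i) f i x).
Proof.
move=> oA h; elim: s => [|i s IH].
  rewrite (_ : (fun _ => _) = cst 0); first exact: Ck_cst.
  by apply/funext => x; rewrite big_nil.
case Pi : (P i).
  rewrite (_ : (fun _ => _) = fun x => f i x + \sum_(j <- s | P j) f j x).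
    by apply: CkD => //; exact: h.
  by apply/funext => x; rewrite big_cons Pi.
rewrite (_ : (fun _ => _) = fun x => \sum_(j <- s | P j) f j x)//.
by apply/funext => x; rewrite big_cons Pi.
Qed.

(** Registering scaling as a bilinear map makes the differential of bilinear maps available for the
    product rule [is_diff_scale]. *)
Lemma scaler_is_bilinear F :
  bilinear_for
    (GRing.Scale.Law.clone _ _ *:%R _) (GRing.Scale.Law.clone _ _ *:%R _)
    (@GRing.scale R F).
Proof.
split=> [u'|u] a x y /=; first by rewrite scalerDl scalerA.
by rewrite scalerDr !scalerA mulrC.
Qed.

HB.instance Definition _ F :=
  bilinear_isBilinear.Build R R F F _ _ (@GRing.scale R F)
  (@scaler_is_bilinear F).

Lemma is_diff_scale E F (a : E -> R) (f : E -> F) x :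
  differentiable a x -> differentiable f x ->
  is_diff x (fun y => a y *: f y) (fun v => a x *: 'd f x v + 'd a x v *: f x).
Proof.
move=> da df.
have sc : continuous (fun p : R * F => p.1 *: p.2).
  by move=> p; exact: scale_continuous.
have ds : is_diff (a x, f x) (fun p : R * F => p.1 *: p.2)
    (fun q => a x *: q.2 + q.1 *: f x).
  apply: DiffDef; first exact: (@differentiable_bilin _ _ _ _ (@GRing.scale R F)).
  by rewrite (@diff_bilin _ _ _ _ (@GRing.scale R F)).
have dp : is_diff x (fun y => (a y, f y)) (fun v => ('d a x v, 'd f x v)).
  by apply: is_diff_pair; exact/differentiableP.
exact: (is_diff_comp dp ds).
Qed.

Lemma CkZ E F k (A : set E) (a : E -> R) (f : E -> F) :
  open A -> Ck k A a -> Ck k A f -> Ck k A (fun x => a x *: f x).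
Proof.
move=> oA; elim: k a f => [|k IH] a f.
  by move=> ha hf x Ax; apply: continuousZ; [exact: ha|exact: hf].
move=> ha hf; have [ha1 ha2] := ha; have [hf1 hf2] := hf.
split=> [x Ax|v].
  by have [] := is_diff_scale (ha1 _ Ax) (hf1 _ Ax).
have h1 := IH _ _ (CkW ha) (hf2 v); have h2 := IH _ _ (ha2 v) (CkW hf).
apply: (Ck_ext oA _ (CkD oA h1 h2)) => x /[!inE] Ax /=.
by have [_ /= ->] := is_diff_scale (ha1 _ Ax) (hf1 _ Ax).
Qed.

Lemma CkM E k (A : set E) (a b : E -> R) :
  open A -> Ck k A a -> Ck k A b -> Ck k A (fun x => a x * b x).
Proof. exact: (@CkZ E R). Qed.

Lemma CkV E k (A : set E) (a : E -> R) : open A -> (forall x, A x -> a x != 0) ->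
  Ck k A a -> Ck k A (fun x => (a x)^-1).
Proof.
move=> oA a0; elim: k => [|k IH] ha.
  by move=> x Ax; apply: continuousV; [exact: a0|exact: ha].
have [ha1 ha2] := ha.
have dV x : A x -> is_diff x (fun y => (a y)^-1) (- (a x) ^- 2 \*: 'd a x).
  move=> Ax; apply: DiffDef.
    by apply: differentiableV; [exact: ha1|exact: a0].
  by rewrite diffV; [|exact: ha1|exact: a0].
split=> [x /dV[]//|v].
have hV := IH (CkW ha).
have h2 := CkM oA (CkM oA (CkM oA (@Ck_cst _ R k A (-1)) hV) hV) (ha2 v).
apply: (Ck_ext oA _ h2) => x /[!inE] /dV[_ /= ->].
by rewrite /cst mulN1r -exprVn expr2 /= mulNr.
Qed.

Lemma Ck_pair E F G k (A : set E) (f : E -> F) (g : E -> G) :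
  open A -> Ck k A f -> Ck k A g -> Ck k A (fun x => (f x, g x)).
Proof.
move=> oA; elim: k f g => [|k IH] f g.
  by move=> hf hg x Ax; apply: cvg_pair; [exact: hf|exact: hg].
move=> [hf1 hf2] [hg1 hg2]; split=> [x Ax|v].
  by apply: differentiable_pair; [exact: hf1|exact: hg1].
apply: (Ck_ext oA _ (IH _ _ (hf2 v) (hg2 v))) => x /[!inE] Ax /=.
by rewrite diff_pair//; [exact: hf1|exact: hg1].
Qed.

(** A finite spanning family with continuous coefficient functionals. No independence is asked for:
    expanding vectors is all that the chain rule for [Ck] uses, and the property passes to
    products. *)
Definition fin_dim F := exists n (b : 'I_n -> F) (l : 'I_n -> {linear F -> R}),
  (forall i, continuous (l i)) /\ forall v, v = \sum_i l i v *: b i.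

(** In ['d g (f x) ('d f x v)] both the point and the direction vary with [x]. Expanding ['d f x v]
    in the vectors [b i] leaves terms ['d g (f x) (b i)] with a fixed direction, to which the
    induction hypothesis applies. *)
Lemma Ck_comp E F G k (A : set E) (B : set F) (f : E -> F) (g : F -> G) :
  fin_dim F -> open A -> (forall x, A x -> B (f x)) ->
  Ck k A f -> Ck k B g -> Ck k A (g \o f).
Proof.
move=> [n [b [l [lc lb]]]] oA AB; elim: k g => [|k IH] g hf hg.
  by move=> x Ax; apply: continuous_comp; [exact: hf|exact/hg/AB].
have [hf1 hf2] := hf; have [hg1 hg2] := hg.
split=> [x Ax|v].
  by apply: (@differentiable_comp _ _ _ _ f g); [exact: hf1|exact/hg1/AB].
have hs : Ck k A (fun x => \sum_i l i ('d f x v) *: ('d g (f x) (b i))).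
  apply: Ck_sum => // i _; apply: CkZ => //.
    exact: (Ck_lin_comp oA (lc i) (hf2 v)).
  exact: (IH (fun y => 'd g y (b i)) (CkW hf) (hg2 (b i))).
apply: (Ck_ext oA _ hs) => x /[!inE] Ax /=.
rewrite (@diff_comp _ _ _ _ f g x (hf1 _ Ax) (hg1 _ (AB _ Ax))) /=.
by rewrite [in RHS](lb ('d f x v)) linear_sum; apply: eq_bigr => i _; rewrite linearZ.
Qed.

Lemma fin_dim_R : fin_dim R.
Proof.
exists 1%N, (fun=> 1), (fun=> idfun); split=> [i x|v]; first exact: cvg_id.
by rewrite big_ord1 /GRing.scale /= mulr1.
Qed.

Definition coord_rV n (j : 'I_n) (u : 'rV[R]_n) : R := u 0 j.

Lemma coord_rV_linear n (j : 'I_n) : linear (coord_rV j).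
Proof. by move=> a u v; rewrite /coord_rV !mxE. Qed.

HB.instance Definition _ n (j : 'I_n) :=
  GRing.isLinear.Build R 'rV[R]_n R _ (coord_rV j) (@coord_rV_linear n j).

Lemma coord_rV_continuous n (j : 'I_n) : continuous (coord_rV j).
Proof. by move=> u; exact: coord_continuous. Qed.

Lemma row_sum_coord n (u : 'rV[R]_n) : u = \sum_j u 0 j *: 'e_j.
Proof. by rewrite {1}[u]row_sum_delta. Qed.

Lemma fin_dim_rV n : fin_dim 'rV[R]_n.
Proof.
exists n, (fun j => 'e_j), (fun j => coord_rV j); split.
  by move=> j; exact: coord_rV_continuous.
exact: row_sum_coord.
Qed.

Lemma fin_dim_prod F G : fin_dim F -> fin_dim G -> fin_dim (F * G)%type.
Proof.
move=> [n [b [l [lc lb]]]] [m [c [k [kc kb]]]].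
exists (n + m)%N, (fun i : 'I_(n + m) =>
  match fintype.split i with inl i => (b i, 0) | inr j => (0, c j) end).
exists (fun i : 'I_(n + m) =>
  match fintype.split i return {linear (F * G)%type -> R} with
   | inl i => (l i \o fst) | inr j => (k j \o snd) end).
split=> [i|[u v]].
  case: (fintype.split i) => j x /=.
    by apply: continuous_comp; [exact: cvg_fst|exact: lc].
  by apply: continuous_comp; [exact: cvg_snd|exact: kc].
rewrite big_split_ord /=.
under eq_bigr => i _ do rewrite (unsplitK (inl i)) /=.
under [X in _ = _ + X]eq_bigr => i _ do rewrite (unsplitK (inr i)) /=.
rewrite [RHS]surjective_pairing /= !(raddf_sum fst) !(raddf_sum snd) /=.
congr pair.
  by rewrite [X in _ + X]big1 ?addr0 => [|i _]; rewrite ?scaler0//; exact: lb.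
by rewrite [X in X + _]big1 ?add0r => [|i _]; rewrite ?scaler0//; exact: kb.
Qed.

Lemma Ck_coord E n k (A : set E) (f : E -> 'rV[R]_n) (j : 'I_n) : open A ->
  Ck k A f -> Ck k A (fun x => f x 0 j).
Proof. by move=> oA; exact: (Ck_lin_comp oA (@coord_rV_continuous n j)). Qed.

Lemma Ck_rV E n k (A : set E) (f : E -> 'rV[R]_n) : open A ->
  (forall j, Ck k A (fun x => f x 0 j)) -> Ck k A f.
Proof.
move=> oA h; rewrite (_ : f = fun x => \sum_j f x 0 j *: 'e_j).
  apply: Ck_sum => // j _; apply: CkZ => //; exact: Ck_cst.
by apply/funext => x; exact: row_sum_coord.
Qed.

End Ck_calculus.

(** * A smooth function on the line that vanishes exactly on the nonpositive half-line *)

Section flat_function.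
Context {R : realType}.
Implicit Types (t : R) (n : nat).

(** The powers [t ^- n] make the family stable under differentiation: the derivative of [flat n] is
    a combination of [flat n.+2] and [flat n.+1]. Smoothness of all members then follows by one
    induction on the order, for all [n] at once. *)
Definition flat n t : R := if 0 < t then t ^- n * expR (- t^-1) else 0.

Lemma flat_gt0 n t : 0 < t -> 0 < flat n t.
Proof. by move=> t0; rewrite /flat t0 mulr_gt0 ?expR_gt0// invr_gt0 exprn_gt0. Qed.

Lemma flat_eq0 n t : t <= 0 -> flat n t = 0.
Proof. by rewrite /flat leNgt => /negbTE ->. Qed.

Lemma flat_ge0 n t : 0 <= flat n t.
Proof. by have [/flat_eq0 ->//|/(flat_gt0 n)/ltW] := leP t 0. Qed.

(** The term of degree n + 2 of the exponential series at 1/t outweighs t^-n by a factor t^-2. The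
    quadratic bound gives [flat n] the derivative 0 at the origin. *)
Lemma flat_le n t : flat n t <= n.+2`!%:R * t ^+ 2.
Proof.
have [t0|t0] := leP t 0; first by rewrite flat_eq0// mulr_ge0 ?sqr_ge0.
have := @expR_ge1Dxn R t^-1 n.+1; rewrite invr_ge0 => /(_ (ltW t0)) h.
rewrite /flat t0 expRN ler_pdivrMr ?expR_gt0//.
have {}h : t ^- n.+2 / n.+2`!%:R <= expR t^-1.
  by apply: le_trans h; rewrite exprVn lerDr.
apply: (@le_trans _ _ (n.+2`!%:R * t ^+ 2 * (t ^- n.+2 / n.+2`!%:R))); last first.
  by rewrite ler_wpM2l// mulr_ge0// sqr_ge0.
rewrite le_eqVlt; apply/orP; left; apply/eqP.
rewrite -addn2 exprD.
field.
by rewrite !expf_neq0 ?gt_eqF ?ltr0n ?fact_gt0.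
Qed.

Lemma is_diff_flat n t :
  is_diff t (flat n) (fun v => v *: (flat n.+2 t - n%:R * flat n.+1 t)).
Proof.
have [t0|t0|->] := ltgtP t 0.
- rewrite !flat_eq0 ?ltW// mulr0 subrr.
  rewrite (_ : (fun _ => _) = 0); last by apply/funext => v; rewrite scaler0.
  apply: (@is_diff_near _ _ _ (cst 0)).
    by near=> s; rewrite flat_eq0// ltW//; near: s; exact: lt_nbhsl.
- have tn0 : t != 0 by rewrite gt_eqF.
  have d1 : is_derive t 1 (fun s : R => s ^- n * expR (- s^-1))
      (flat n.+2 t - n%:R * flat n.+1 t).
    have dV : is_derive t 1 (fun s : R => s^-1) (- t ^- 2).
      have := @is_deriveV R id t 1 1 tn0 (is_derive_id t 1).
      by rewrite /GRing.scale /= mulr1.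
    have dE := is_derive1_comp (is_derive_expR _) (is_deriveN dV).
    have dM := is_deriveM (is_deriveX n dV) dE.
    have fE : (fun s : R => s^-1) ^+ n * (expR \o (- (fun s : R => s^-1))) =
        (fun s : R => s ^- n * expR (- s^-1)).
      by apply/funext => s; rewrite fctE exprfctE exprVn.
    rewrite fE in dM; apply: is_derive_eq dM _.
    rewrite /flat t0 !fctE /GRing.scale /=.
    by case: (n) => [|m] /=; rewrite -!exprVn !exprS; ring.
  have [d2 d3] := d1.
  apply: (@is_diff_near _ _ _ (fun s : R => s ^- n * expR (- s^-1))).
    near=> s; rewrite /flat ifT//; near: s; exact: lt_nbhsr.
  apply: DiffDef; first exact/derivable1_diffP.
  by rewrite deriv1E// derive1E d3.
- rewrite !flat_eq0// mulr0 subrr.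
  rewrite (_ : (fun _ => _) = 0); last by apply/funext => v; rewrite scaler0.
  apply: is_diff0 => e e0.
  have c0 : 0 < (n.+2)`!%:R :> R by rewrite ltr0n fact_gt0.
  near=> h.
  rewrite addr0 (@flat_eq0 n 0)// subr0 ger0_norm ?flat_ge0//.
  apply: le_trans (flat_le _ _) _.
  rewrite -real_normK ?num_real// expr2 mulrA ler_wpM2r// mulrC -ler_pdivlMr//.
  near: h; exact: (@nbhs0_le R R _ (divr_gt0 e0 c0)).
Unshelve. all: by end_near. Qed.

Lemma Ck_flat k n (A : set R) : open A -> Ck k A (flat n).
Proof.
move=> oA; elim: k n => [|k IH] n.
  by move=> t _; apply/differentiable_continuous; have [] := is_diff_flat n t.
split=> [t _|v]; first by have [] := is_diff_flat n t.
have h : Ck k A (fun t => cst v t * (flat n.+2 t + cst (- n%:R) t * flat n.+1 t)).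
  apply: CkM => //; first exact: Ck_cst.
  by apply: CkD => //; apply: CkM => //; exact: Ck_cst.
apply: (Ck_ext oA _ h) => t _; have [_ ->] := is_diff_flat n t.
by rewrite /cst mulNr.
Qed.

End flat_function.

(** * Smooth maps and smooth functions on manifolds *)

Lemma open_setX (S T : topologicalType) (A : set S) (B : set T) :
  open A -> open B -> open (A `*` B).
Proof.
move=> oA oB; rewrite (_ : A `*` B = fst @^-1` A `&` snd @^-1` B)//.
by apply: openI; apply: open_comp => // x _; [exact: cvg_fst|exact: cvg_snd].
Qed.

Section smooth_maps.
Context {R : realType}.
Implicit Types (E F G : normedModType R).

(** The part of the manifold axioms that also holds for vector spaces and products; [trivial_bundle]
    is a [charted] space and not a [manifold]. *)
Definition charted_ok E (X : charted E) :=
  [/\ fin_dim E, forall c, @atlas _ _ X c -> is_chart c &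
      forall x : X, exists2 c, atlas c & chart_dom c x].

(** Openness of the coordinate domains occurring in [smooth_on], as required by [Ck_ext] and the
    other closure properties of [Ck]. *)
Lemma open_chart_pre E (X : charted E) (T : topologicalType) (c : chart X E)
    (U : set X) (D : set T) (f : X -> T) :
  is_chart c -> open U -> open D -> (forall x, U x -> {for x, continuous f}) ->
  open [set y | [/\ chart_cod c y, U (chart_inv c y) & D (f (chart_inv c y))]].
Proof.
move=> [[od oc] [dc cd] _ [cm ci]] oU oD fc; rewrite openE => y [cy Uy Dy].
have ciy := ci _ cy.
have h1 : nbhs y (chart_cod c) by apply: open_nbhs_nbhs.
have h2 : \forall z \near y, U (chart_inv c z).
  by apply: ciy; apply: open_nbhs_nbhs.
have h3 : \forall z \near y, D (f (chart_inv c z)).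
  have fciy : {for y, continuous (f \o chart_inv c)}.
    by apply: continuous_comp => //; exact: fc.
  by apply: fciy; apply: open_nbhs_nbhs.
by near=> z; split; near: z.
Unshelve. all: by end_near. Qed.

Lemma open_chart_pre1 E (X : charted E) (c : chart X E) (U : set X) :
  is_chart c -> open U ->
  open [set y | chart_cod c y /\ U (chart_inv c y)].
Proof.
move=> hc oU.
rewrite (_ : [set y | _] =
  [set y | [/\ chart_cod c y, U (chart_inv c y) & setT (id (chart_inv c y))]]).
  apply: (@open_chart_pre _ _ _ c U setT id) => //; first exact: openT.
  by move=> x _; exact: cvg_id.
by apply/seteqP; split=> y /= []; split.
Qed.

Lemma smooth_on_sub E F (X : charted E) (Y : charted F) (U W : set X) (f : X -> Y) :
  U `<=` W -> smooth_on W f -> smooth_on U f.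
Proof.
move=> UW [fc fs]; split=> [x /UW/fc//|c d cX dY k].
by apply: (Ck_sub _ (fs c d cX dY k)) => y [? /UW].
Qed.

Lemma smooth_on_local E F (X : charted E) (Y : charted F) (U : set X) (f : X -> Y) :
  (forall x, U x -> exists2 W, W x & smooth_on W f) -> smooth_on U f.
Proof.
move=> h; split=> [x /h[W Wx [fc _]]|c d cX dY k]; first exact: fc.
apply: Ck_local => y [cy /h[W Wy [_ fs]] dy].
by eexists; last exact: (fs c d cX dY k).
Qed.

Lemma smooth_on_ext E F (X : charted E) (Y : charted F) (U : set X) (f g : X -> Y) :
  charted_ok X -> charted_ok Y ->
  open U -> {in U, f =1 g} -> smooth_on U f -> smooth_on U g.
Proof.
move=> [_ okX _] [_ okY _] oU fg [fc fs].
split=> [x Ux|c d cX dY k].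
  have hx : f y @[y --> x] --> g x by rewrite -fg ?inE//; exact: fc.
  apply: cvg_trans hx; apply: near_eq_cvg.
  by apply: filterS (open_nbhs_nbhs (conj oU Ux)) => y Uy; rewrite fg ?inE.
have [[od _] _ _ _] := okY _ dY.
rewrite (_ : [set y | _] = [set y | [/\ chart_cod c y, U (chart_inv c y)
     & chart_dom d (f (chart_inv c y))]]); last first.
  by apply/seteqP; split=> y /= [h1 h2 h3]; split=> //; move: h3; rewrite fg ?inE.
apply: (Ck_ext _ _ (fs c d cX dY k)).
  exact: open_chart_pre (okX _ cX) oU od fc.
by move=> y /[!inE] -[_ Uy _] /=; rewrite fg ?inE.
Qed.

(** In coordinates, insert [chart_inv e \o chart_map e] between the two maps, for a chart [e] of the
    middle space about the image point. By [Ck_local], [e] may depend on the point. *)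
Lemma smooth_on_comp E F G (X : charted E) (Y : charted F) (Z : charted G)
    (U : set X) (W : set Y) (f : X -> Y) (g : Y -> Z) :
  charted_ok X -> charted_ok Y -> charted_ok Z -> open U ->
  (forall x, U x -> W (f x)) -> smooth_on U f -> smooth_on W g ->
  smooth_on U (g \o f).
Proof.
move=> [_ okX _] [fdY okY covY] [_ okZ _] oU UW [fc fs] [gc gs].
have gfc x : U x -> {for x, continuous (g \o f)}.
  by move=> Ux; apply: continuous_comp; [exact: fc|exact/gc/UW].
split=> // c d cX dZ k; apply: Ck_local => y0 [cy0 Uy0 dy0].
have [e eY ey0] := covY (f (chart_inv c y0)).
have [[ode _] [ede _] [eK _] _] := okY _ eY.
have [[odd _] _ _ _] := okZ _ dZ.
pose A1 := [set y | [/\ chart_cod c y, U (chart_inv c y)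
   & chart_dom e (f (chart_inv c y))]].
pose A2 := [set y | [/\ chart_cod c y, U (chart_inv c y)
   & chart_dom d ((g \o f) (chart_inv c y))]].
have oA : open (A1 `&` A2).
  by apply: openI; apply: open_chart_pre => //; exact: okX.
exists (A1 `&` A2) => //.
have := Ck_comp fdY oA _ (Ck_sub (@subIsetl _ A1 A2) (fs c e cX eY k))
  (gs e d eY dZ k).
move=> h; apply: (Ck_ext oA _ (h _)).
  by move=> y /[!inE] -[[_ _ /eK ey] _] /=; rewrite ey.
move=> y [[_ Uy ey] [_ _ dy]] /=; split; first exact: ede.
  by rewrite eK//; exact: UW.
by rewrite eK.
Qed.

(** The identity is the only chart of the target, so its domain imposes no condition, and continuity
    comes back from the case [k = 0] by composing with a chart. *)
Lemma smooth_on_modelP E F (X : charted E) (U : set X) (f : X -> F) :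
  charted_ok X -> open U ->
  (smooth_on (N := model_charted F) U f <->
   forall c, atlas c ->
     Cinfty [set y | chart_cod c y /\ U (chart_inv c y)] (f \o chart_inv c)).
Proof.
move=> [_ okX covX] oU.
have setE (c : chart X E) : [set y | [/\ chart_cod c y, U (chart_inv c y) &
    chart_dom (Chart setT setT id id : chart F F) (f (chart_inv c y))]] =
    [set y | chart_cod c y /\ U (chart_inv c y)].
  by apply/seteqP; split=> y /= []; split.
split=> [[fc fs] c cX k|fs].
  by have := fs c (Chart setT setT id id) cX erefl k; rewrite setE.
split=> [x Ux|c _ cX -> k]; last by rewrite setE; exact: fs.
have [c cX cx] := covX x.
have [[od oc] [dc cd] [cK Kc] [cm ci]] := okX _ cX.
have fcx : {for chart_map c x, continuous (f \o chart_inv c)}.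
  by apply: (fs c cX 0%N) => /=; rewrite cK//; split=> //; exact: dc.
have h : f (chart_inv c (chart_map c y)) @[y --> x] --> f x.
  by rewrite -{2}(cK _ cx); exact: (continuous_comp (cm _ cx) fcx).
apply: cvg_trans h; apply: near_eq_cvg.
by apply: filterS (open_nbhs_nbhs (conj od cx)) => y cy /=; rewrite cK.
Qed.

Lemma model_charted_ok F : fin_dim F -> charted_ok (model_charted F).
Proof.
move=> fdF; split=> //; last by move=> x; exists (Chart setT setT id id).
move=> _ ->; split=> //=; split=> //; try exact: openT.
  by move=> x _; exact: cvg_id.
by move=> x _; exact: cvg_id.
Qed.

Lemma prod_charted_ok E F (X : charted E) (Y : charted F) :
  charted_ok X -> charted_ok Y -> charted_ok (prod_charted X Y).
Proof.
move=> [fE okX covX] [fF okY covY]; split; first exact: fin_dim_prod.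
  move=> _ [c [d [/okX hc /okY hd ->]]].
  have [[odc occ] [dcc cdc] [cK Kc] [cmc cic]] := hc.
  have [[odd ocd] [dcd cdd] [dK Kd] [cmd cid]] := hd.
  split=> /=.
  - by split; exact: open_setX.
  - split=> -[x y] [/= hx hy]; split=> /=.
    + exact: dcc.
    + exact: dcd.
    + exact: cdc.
    + exact: cdd.
  - by split=> -[x y] [/= hx hy] /=; rewrite ?cK ?dK ?Kc ?Kd.
  - split=> -[x y] [/= hx hy].
    + apply: cvg_pair => /=.
        by apply: (@continuous_comp _ _ _ fst (chart_map c) (x, y));
          [exact: cvg_fst|exact: cmc].
      by apply: (@continuous_comp _ _ _ snd (chart_map d) (x, y));
        [exact: cvg_snd|exact: cmd].
    + apply: cvg_pair => /=.
        by apply: (@continuous_comp _ _ _ fst (chart_inv c) (x, y));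
          [exact: cvg_fst|exact: cic].
      by apply: (@continuous_comp _ _ _ snd (chart_inv d) (x, y));
        [exact: cvg_snd|exact: cid].
move=> [x y]; have [c cX cx] := covX x; have [d dY dy] := covY y.
by exists (prod_chart c d) => //; exists c, d.
Qed.

Lemma smooth_on_pair E F G (X : charted E) (Y : charted F) (Z : charted G)
    (U : set X) (f : X -> Y) (g : X -> Z) :
  charted_ok X -> charted_ok Y -> charted_ok Z -> open U ->
  smooth_on U f -> smooth_on U g ->
  smooth_on (N := prod_charted Y Z) U (fun x => (f x, g x)).
Proof.
move=> [_ okX _] [_ okY _] [_ okZ _] oU [fc fs] [gc gs].
split=> [x Ux|c _ cX [d [e [dY eZ ->]]] k].
  by apply: cvg_pair; [exact: fc|exact: gc].
pose A1 := [set y | [/\ chart_cod c y, U (chart_inv c y)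
   & chart_dom d (f (chart_inv c y))]].
pose A2 := [set y | [/\ chart_cod c y, U (chart_inv c y)
   & chart_dom e (g (chart_inv c y))]].
have [[od _] _ _ _] := okY _ dY; have [[oe _] _ _ _] := okZ _ eZ.
have oA : open (A1 `&` A2).
  by apply: openI; apply: open_chart_pre => //; exact: okX.
have := Ck_pair oA (Ck_sub (@subIsetl _ A1 A2) (fs c d cX dY k))
  (Ck_sub (@subIsetr _ A1 A2) (gs c e cX eZ k)).
by apply: Ck_sub => y [? ? [? ?]].
Qed.

Lemma smooth_on_snd E F G (X : charted E) (Y : charted F)
    (U : set X) (t : X -> prod_charted Y (model_charted G)) :
  charted_ok X -> charted_ok Y -> fin_dim G -> open U -> smooth_on U t ->
  smooth_on (N := model_charted G) U (fun x => (t x).2).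
Proof.
move=> okX okY fG oU [tc ts]; apply/smooth_on_modelP => // c cX k.
have [_ hX _] := okX; have [_ hY covY] := okY.
apply: Ck_local => y0 [cy0 Uy0].
have [e eY ey0] := covY (t (chart_inv c y0)).1.
have [[oe _] _ _ _] := hY _ eY.
have t1c x : U x -> {for x, continuous (fun x => (t x).1)}.
  by move=> Ux; apply: (@continuous_comp _ _ _ t fst x); [exact: tc|exact: cvg_fst].
pose A := [set y | [/\ chart_cod c y, U (chart_inv c y)
   & chart_dom e (t (chart_inv c y)).1]].
have oA : open A by apply: open_chart_pre (hX _ cX) oU oe t1c.
exists A => //.
have mX : @atlas _ _ (prod_charted Y (model_charted G))
    (prod_chart e (Chart setT setT id id)) by exists e, (Chart setT setT id id).
have tk : Ck k A (chart_map (prod_chart e (Chart setT setT id id)) \o t \o chart_inv c).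
  by apply: (Ck_sub _ (ts c _ cX mX k)) => y [].
have := Ck_lin_comp oA _ tk; move=> /(_ G snd); apply.
by move=> z; exact: cvg_snd.
Qed.

End smooth_maps.

(** * Smooth real functions, bump functions and locally finite families *)

Section smooth_functions.
Context {R : realType}.

Lemma mfd_ok (M : manifold R) : charted_ok M.
Proof.
split; [exact: fin_dim_rV|exact: mfd_chartP|exact: mfd_cover].
Qed.

Definition sfn (M : manifold R) (U : set M) (f : M -> R) :=
  smooth_on (N := model_charted R) U f.

Variable M : manifold R.
Implicit Types (U W : set M) (f g : M -> R).

Lemma sfnP U f : open U -> (sfn U f <->
   forall c, @atlas _ _ M c ->
     Cinfty [set y | chart_cod c y /\ U (chart_inv c y)] (f \o chart_inv c)).
Proof. by move=> oU; exact: smooth_on_modelP (mfd_ok M) oU. Qed.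

Lemma sfn_continuous U f : sfn U f -> forall x, U x -> {for x, continuous f}.
Proof. by case. Qed.

Lemma open_pre1 (c : chart M (euclidean R (mfd_dim M))) U :
  atlas c -> open U ->
  open [set y | chart_cod c y /\ U (chart_inv c y)].
Proof. by move=> cM oU; apply: open_chart_pre1 => //; exact: mfd_chartP. Qed.

Lemma sfn_ext U f g : open U -> {in U, f =1 g} -> sfn U f -> sfn U g.
Proof.
exact: (smooth_on_ext (mfd_ok M) (model_charted_ok fin_dim_R)).
Qed.

Lemma sfn_cst U (a : R) : open U -> sfn U (fun=> a).
Proof. by move=> oU; apply/sfnP => // c cM k; exact: Ck_cst. Qed.

Lemma sfnD U f g : open U -> sfn U f -> sfn U g -> sfn U (fun x => f x + g x).
Proof.
move=> oU /(sfnP _ oU) hf /(sfnP _ oU) hg; apply/sfnP => // c cM k.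
by apply: CkD; [exact: open_pre1|exact: hf|exact: hg].
Qed.

Lemma sfnM U f g : open U -> sfn U f -> sfn U g -> sfn U (fun x => f x * g x).
Proof.
move=> oU /(sfnP _ oU) hf /(sfnP _ oU) hg; apply/sfnP => // c cM k.
by apply: CkM; [exact: open_pre1|exact: hf|exact: hg].
Qed.

Lemma sfnV U f : open U -> (forall x, U x -> f x != 0) ->
  sfn U f -> sfn U (fun x => (f x)^-1).
Proof.
move=> oU f0 /(sfnP _ oU) hf; apply/sfnP => // c cM k.
apply: (@CkV _ _ _ _ (f \o chart_inv c)); [exact: open_pre1| |exact: hf].
by move=> y [_ /f0].
Qed.

Lemma sfn_flat U f n : open U -> sfn U f -> sfn U (fun x => flat n (f x)).
Proof.
move=> oU /(sfnP _ oU) hf; apply/sfnP => // c cM k.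
apply: (@Ck_comp _ _ _ _ _ _ setT (f \o chart_inv c) (flat n)) => //.
- exact: fin_dim_R.
- exact: open_pre1.
- exact: hf.
- by apply: Ck_flat; exact: openT.
Qed.

Lemma sfn_sum U (I : Type) (s : seq I) (P : pred I) (F : I -> M -> R) : open U ->
  (forall i, P i -> sfn U (F i)) -> sfn U (fun x => \sum_(i <- s | P i) F i x).
Proof.
move=> oU hF; apply/sfnP => // c cM k.
apply: (@Ck_sum _ _ _ _ _ _ _ _ (fun i => F i \o chart_inv c)).
  exact: open_pre1.
by move=> i /hF /(sfnP _ oU); exact.
Qed.

Lemma sfn_prod U (I : Type) (s : seq I) (P : pred I) (F : I -> M -> R) : open U ->
  (forall i, P i -> sfn U (F i)) -> sfn U (fun x => \prod_(i <- s | P i) F i x).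
Proof.
move=> oU hF; elim: s => [|i s IH].
  rewrite (_ : (fun _ => _) = fun=> 1); first exact: sfn_cst.
  by apply/funext => x; rewrite big_nil.
case Pi : (P i).
  rewrite (_ : (fun _ => _) = fun x => F i x * \prod_(j <- s | P j) F j x).
    by apply: sfnM => //; exact: hF.
  by apply/funext => x; rewrite big_cons Pi.
rewrite (_ : (fun _ => _) = fun x => \prod_(j <- s | P j) F j x)//.
by apply/funext => x; rewrite big_cons Pi.
Qed.

Lemma sfn_chart (c : chart M (euclidean R (mfd_dim M))) j :
  atlas c -> sfn (chart_dom c) (fun x => chart_map c x 0 j).
Proof.
move=> cM; have [[oc _] _ _ _] := mfd_chartP cM.
apply/sfnP => // d dM k.
apply: (@Ck_coord _ _ _ _ _ (chart_map c \o chart_inv d)); first exact: open_pre1.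
exact: mfd_compat.
Qed.

(** In a chart, the product over the coordinates of a [flat] bump is positive exactly on an open
    cube about the point; it is extended by 0 outside the chart. *)
Lemma bump (x0 : M) W : open W -> W x0 -> exists (f : M -> R) (C : set M),
  [/\ sfn setT f, forall x, 0 <= f x, 0 < f x0, closed C /\ C `<=` W &
      forall x, ~ C x -> f x = 0].
Proof.
move=> oW Wx0; have [c cM cx0] := mfd_cover x0.
have [[od oc] [dc cd] [cK Kc] [cm ci]] := mfd_chartP cM.
set y0 := chart_map c x0.
have /nbhs_ballP[e /= e0 eW] : nbhs y0 [set y | chart_cod c y /\ W (chart_inv c y)].
  by apply: open_nbhs_nbhs; split; [exact: open_pre1|rewrite /= cK//; split=> //; exact: dc].
(* Balls of row vectors are cubes, as they are taken entrywise; half the radius puts the closed cube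
   [K] inside the ball of radius [e]. *)
pose K := [set y : 'rV[R]_(mfd_dim M) | forall j,
  `[y0 0 j - e / 2, y0 0 j + e / 2]%classic (y 0 j)].
have Kcpt : compact K.
  exact: (@rV_compact R _ (fun j => `[y0 0 j - e / 2, y0 0 j + e / 2]%classic)
     (fun j => @segment_compact R _ _)).
have KP (y : 'rV[R]_(mfd_dim M)) : (forall j, `|y 0 j - y0 0 j| <= e / 2) -> K y.
  by move=> h j; rewrite /= in_itv /= -ler_distlC distrC.
have KW y : K y -> chart_cod c y /\ W (chart_inv c y).
  move=> Ky; apply: eW; split=> // i j; rewrite ord1 /ball /=.
  move: (Ky j); rewrite /= in_itv /= -ler_distlC => /le_lt_trans; apply.
  by rewrite ltr_pdivrMr// ltr_pMr// ltr1n.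
pose C := chart_inv c @` K.
(* The Hausdorff axiom enters here. Closedness in all of [M], and not just in the chart domain,
   makes the extension by 0 smooth. *)
have Ccl : closed C.
  apply: compact_closed; first exact: mfd_hausdorff.
  apply: continuous_compact => //; apply: continuous_in_subspaceT => y /[!inE] Ky.
  by apply: ci; have [] := KW _ Ky.
pose f x := if `[< chart_dom c x >] then
  \prod_j flat 0 ((e / 2) ^+ 2 - (chart_map c x 0 j - y0 0 j) ^+ 2) else 0.
have fC x : ~ C x -> f x = 0.
  rewrite /f; case: asboolP => // dx nC; apply/eqP; apply: contra_notT nC => p0.
  exists (chart_map c x); last by rewrite cK.
  apply: KP => j; move: p0; rewrite prodf_seq_neq0 => /allP /(_ j).
  rewrite mem_index_enum => /(_ isT); apply: contraNT; rewrite -ltNge => h.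
  rewrite flat_eq0// subr_le0 -[leRHS]real_normK ?num_real//.
  by rewrite ler_pXn2r ?nnegrE ?divr_ge0 ?normr_ge0 ?ltW.
exists f, C; split => //.
(* Two open sets cover [M]: the chart domain, where the product formula holds, and the complement of
   [C], where [f] is 0. *)
- apply: smooth_on_local => x _.
  have [dx|ndx] := pselect (chart_dom c x).
    exists (chart_dom c) => //.
    apply: (@sfn_ext _ (fun x => \prod_j flat 0 ((e / 2) ^+ 2 -
        (chart_map c x 0 j - y0 0 j) ^+ 2))) => //.
      by move=> y /[!inE] dy; rewrite /f asboolT.
    apply: sfn_prod => // j _; apply: sfn_flat => //; apply: sfnD => //.
      exact: sfn_cst.
    rewrite (_ : (fun _ => _) = fun x => (-1) * ((chart_map c x 0 j + - y0 0 j) *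
      (chart_map c x 0 j + - y0 0 j))).
      apply: sfnM => //; first exact: sfn_cst.
      have h : sfn (chart_dom c) (fun x => chart_map c x 0 j + - y0 0 j).
        by apply: sfnD => //; [exact: sfn_chart|exact: sfn_cst].
      exact: sfnM.
    by apply/funext => z; rewrite mulN1r expr2.
  exists (~` C); first by move=> -[y /KW[cy _] yx]; apply: ndx; rewrite -yx; exact: cd.
  apply: (@sfn_ext _ (fun=> 0)); first exact: closed_openC.
    by move=> y /[!inE] /fC ->.
  by apply: sfn_cst; exact: closed_openC.
- by move=> x; rewrite /f; case: asboolP => // _; apply: prodr_ge0 => j _; exact: flat_ge0.
- rewrite /f asboolT//; apply: prodr_gt0 => j _; apply: flat_gt0.
  by rewrite subrr expr0n subr0 exprn_gt0// divr_gt0.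
- split=> // _ [y /KW[_ Wy] <-]; exact: Wy.
Qed.

(* Mather's trick: multiplying the i-th function of a countable family by a
   factor that vanishes where an earlier one exceeds [i.+1%:R^-1] makes the
   family locally finite. *)
Lemma smooth_partition (x0 : M) (P : set M -> Prop) :
  (forall x, exists W, [/\ open W, W x & P W]) ->
  exists (g : nat -> M -> R) (W C : nat -> set M),
  [/\ forall i, sfn setT (g i) /\ forall x, 0 <= g i x,
      forall i, [/\ open (W i), P (W i), closed (C i), C i `<=` W i &
        forall x, ~ C i x -> g i x = 0],
      forall x, exists U (N : nat), [/\ open U, U x &
        forall i y, (N <= i)%N -> U y -> g i y = 0] &
      forall x, exists i, 0 < g i x].
Proof.
move=> hP.
have /choice[D hD] x : exists d : (M -> R) * (set M * set M),
    [/\ sfn setT d.1 /\ (forall y, 0 <= d.1 y), 0 < d.1 x,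
     open d.2.1 /\ P d.2.1, closed d.2.2 /\ d.2.2 `<=` d.2.1 &
     forall y, ~ d.2.2 y -> d.1 y = 0].
  have [W [oW Wx PW]] := hP x; have [f [C [h1 h2 h3 h4 h5]]] := bump oW Wx.
  by exists (f, (W, C)).
have Dc x : continuous (D x).1.
  by move=> y; have [[/sfn_continuous h _] _ _ _ _] := hD x; exact: h.
have [B /countable_injP[nB injB] [oB bB]] := @mfd_second_countable _ M.
(* Lindelöf argument: [Q i x] says that the bump at [x] is positive on the basic set numbered [i].
   Choosing one such centre [p i] per number gives a countable family. If there is none, [p i] is
   [x0], whose bump is equally admissible. *)
pose Q i x := exists U, [/\ B U, nB U = i & forall y, U y -> 0 < (D x).1 y].
pose p i := xget x0 (Q i).
have pcov y : exists i, 0 < (D (p i)).1 y.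
  have [_ Dy _ _ _] := hD y.
  have : nbhs y [set z | 0 < (D y).1 z].
    apply: open_nbhs_nbhs; split=> //.
    apply: (@open_comp _ _ (D y).1 [set r | 0 < r]); last exact: open_gt.
    by move=> z _; exact: Dc.
  move=> /bB[U [BU Uy] UD].
  have QU : Q (nB U) y by exists U.
  exists (nB U); have : Q (nB U) (p (nB U)) by exact: (xgetPex x0 (ex_intro _ _ QU)).
  move=> [U' [BU' /injB]]; rewrite !inE => /(_ BU' BU) -> ; exact.
pose f i := (D (p i)).1.
have f0 i x : 0 <= f i x by have [[_ h] _ _ _ _] := hD (p i); exact: h.
pose g i x := f i x * \prod_(j < i) flat 0 (i.+1%:R^-1 - f j x).
exists g, (fun i => (D (p i)).2.1), (fun i => (D (p i)).2.2).
split=> [i|i|x|x].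
- split=> [|x]; last by rewrite mulr_ge0// prodr_ge0// => j _; exact: flat_ge0.
  have sf j : sfn setT (f j) by have [[]] := hD (p j).
  apply: sfnM => //; first exact: openT.
  apply: sfn_prod => [|j _]; first exact: openT.
  apply: sfn_flat; first exact: openT.
  apply: sfnD; [exact: openT|by apply: sfn_cst; exact: openT|].
  rewrite (_ : (fun _ => _) = fun x => -1 * f j x); last first.
    by apply/funext => z; rewrite mulN1r.
  by apply: sfnM; [exact: openT|by apply: sfn_cst; exact: openT|exact: sf].
- have [_ _ [h1 h2] [h3 h4] h5] := hD (p i); split=> // x /h5 fx.
  by rewrite /g /f fx mul0r.
- have [m fm] := pcov x.
  pose U := [set y | f m x / 2 < f m y].
  (* The first bound puts the factor of index [m] into the product. The second makes [i.+1%:R^-1] at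
     most [f m x / 2], which is below [f m] on [U], so that this factor vanishes. *)
  exists U, (maxn m.+1 (Num.truncn (f m x / 2)^-1).+1); split.
  + apply: (@open_comp _ _ (f m) [set r | f m x / 2 < r]); last exact: open_gt.
    by move=> z _; exact: Dc.
  + by rewrite /U /= ltr_pdivrMr// ltr_pMr// ltr1n.
  + move=> i y; rewrite geq_max => /andP[mi Ni] Uy.
    rewrite /g (bigD1 (Ordinal mi))//= flat_eq0 ?mul0r ?mulr0//.
    rewrite subr_le0 (le_trans _ (ltW Uy))// invf_ple ?posrE ?divr_gt0//.
    rewrite ltW// (lt_le_trans (truncnS_gt _))// ler_nat.
    exact: leq_trans Ni _.
- have ex : exists i, 0 < f i x by exact: pcov.
  (* At the least index with [f i x] positive all earlier functions vanish at [x], so every factor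
     is [flat 0] of a positive number. *)
  case: (ex_minnP ex) => i fi imin; exists i.
  rewrite mulr_gt0// prodr_gt0// => j _; apply: flat_gt0.
  rewrite subr_gt0 (_ : f j x = 0) ?invr_gt0//.
  apply/eqP; rewrite eq_le f0 andbT leNgt; apply/negP => /imin.
  by rewrite leqNgt ltn_ord.
Qed.

End smooth_functions.

(** * Vector bundles and global frames *)

Lemma cvg_bigsum (R : realType) (F : normedModType R) (T I : Type)
    (Fi : set_system T) (FF : Filter Fi) (s : seq I) (P : pred I)
    (f : I -> T -> F) (a : I -> F) :
  (forall i, P i -> f i x @[x --> Fi] --> a i) ->
  \sum_(i <- s | P i) f i x @[x --> Fi] --> \sum_(i <- s | P i) a i.
Proof.
move=> h; elim: s => [|i s IH].
  rewrite big_nil; under eq_fun do rewrite big_nil; exact: cvg_cst.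
rewrite big_cons; under eq_fun do rewrite big_cons.
by case Pi : (P i) => //; apply: cvgD => //; exact: h.
Qed.

Lemma continuous_near (S T : topologicalType) (f g : S -> T) x :
  {near x, f =1 g} -> {for x, continuous f} -> {for x, continuous g}.
Proof.
move=> fg fc; have h : f y @[y --> x] --> g x by rewrite -(nbhs_singleton fg); exact: fc.
apply: cvg_trans h; apply: near_eq_cvg.
by apply: filterS fg => y ->.
Qed.

Lemma lin_sum (R : realType) (U W : lmodType R) (f : U -> W) (hf : linear f)
    (N : nat) (k : 'I_N -> R) (u : 'I_N -> U) :
  f (\sum_i k i *: u i) = \sum_i k i *: f (u i).
Proof.
pose fM := GRing.isLinear.Build _ _ _ _ f hf.
pose fL : {linear U -> W} := HB.pack f fM.
rewrite -[f]/(fL : U -> W) linear_sum; apply: eq_bigr => i _.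
by rewrite linearZ.
Qed.

Lemma lin_sum2 (R : realType) (U W : lmodType R) (f : U -> W) (hf : linear f)
    (N r : nat) (k : 'I_N -> 'I_r -> R) (u : 'I_N -> 'I_r -> U) :
  f (\sum_i \sum_a k i a *: u i a) = \sum_i \sum_a k i a *: f (u i a).
Proof.
under eq_bigr => i _ do rewrite -[\sum_a _]scale1r.
rewrite (lin_sum hf); apply: eq_bigr => i _.
by rewrite scale1r (lin_sum hf).
Qed.

Lemma lin0 (R : realType) (U W : lmodType R) (f : U -> W) (hf : linear f) : f 0 = 0.
Proof.
pose fM := GRing.isLinear.Build _ _ _ _ f hf.
by pose fL : {linear U -> W} := HB.pack f fM; exact: (linear0 fL).
Qed.

Lemma smooth_on_id (R : realType) (M : manifold R) (U : set M) :
  smooth_on (M := M) (N := M) U id.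
Proof.
split=> [x _|c d cM dM k]; first exact: cvg_id.
by apply: (Ck_sub _ (mfd_compat cM dM k)) => y [].
Qed.

Lemma sfn_comp (R : realType) (M N : manifold R) (U : set M) (W : set N)
    (g : M -> N) (f : N -> R) : open U -> (forall x, U x -> W (g x)) ->
  smooth_on U g -> sfn W f -> sfn U (f \o g).
Proof.
exact: (smooth_on_comp (mfd_ok M) (mfd_ok N) (model_charted_ok fin_dim_R)).
Qed.

Section bundle.
Context {R : realType} {M : manifold R} (V : vector_bundle M).
Local Notation pr := (@bundle_proj _ _ V).
Local Notation r := (bundle_rank V).
Local Notation incl := (@fibre_incl _ _ V _).
Local Notation TB := (trivial_bundle M r).

(** Maps of [V] act on the total space, whereas sums and scalings exist only in the types
    [fibre V x]; [fcoord] leads back from the former to the latter. Its value off the fibre over [x]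
    is 0. *)
Definition fcoord (x : M) (w : V) : fibre V x :=
  xget 0 [set u : fibre V x | fibre_incl u = w].

Lemma pr_incl (x : M) (u : fibre V x) : pr (incl u) = x.
Proof.
have : (pr @^-1` [set x]) (incl u) by rewrite -fibre_incl_range; exists u.
by [].
Qed.

Lemma fcoordK (x : M) (w : V) : pr w = x -> incl (fcoord x w) = w.
Proof.
move=> wx; have : (pr @^-1` [set x]) w by [].
rewrite -fibre_incl_range => -[u _ uw].
exact: (xgetPex 0 (ex_intro [set u : fibre V x | fibre_incl u = w] u uw)).
Qed.

Lemma inclK (x : M) (u : fibre V x) : fcoord x (incl u) = u.
Proof. by apply: fibre_incl_inj; rewrite fcoordK// pr_incl. Qed.

Lemma pr_continuous : continuous pr.
Proof. by move=> v; have [h _] := bundle_proj_smooth V; exact: h. Qed.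

Definition trivialization (U : set M) (t : V -> TB) (s : TB -> V) :=
  [/\ open U,
      smooth_on (pr @^-1` U) t /\ smooth_on [set w : TB | U w.1] s,
      (forall v, U (pr v) -> (t v).1 = pr v /\ s (t v) = v),
      (forall w, U w.1 -> pr (s w) = w.1 /\ t (s w) = w)
    & forall y, U y -> linear (fun u : fibre V y => (t (incl u)).2)].

Lemma trivialization_at (x : M) : exists U t s, trivialization U t s /\ U x.
Proof.
have [U [t [s [[oU Ux] h1 h2 h3 h4]]]] := local_triviality V x.
by exists U, t, s; split.
Qed.

Definition tcoord (t : V -> TB) (a : 'I_r) (v : V) : R := (t v).2 0 a.

Lemma TB_ok : charted_ok TB.
Proof. by apply: prod_charted_ok; [exact: mfd_ok|exact/model_charted_ok/fin_dim_rV]. Qed.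

Section one_trivialization.
Context (U : set M) (t : V -> TB) (s : TB -> V) (tP : trivialization U t s).

Lemma triv_open : open U. Proof. by case: tP. Qed.

Lemma triv_open_pr : open (pr @^-1` U).
Proof. by apply: open_comp triv_open => v _; exact: pr_continuous. Qed.

Lemma triv_linear y : U y -> forall a,
  linear ((fun u : fibre V y => tcoord t a (incl u)) : _ -> R^o).
Proof.
move=> Uy a k u v; have [_ _ _ _ /(_ _ Uy) h] := tP.
by rewrite /tcoord h !mxE.
Qed.

Lemma triv_inj y (u v : fibre V y) : U y ->
  (forall a, tcoord t a (incl u) = tcoord t a (incl v)) -> u = v.
Proof.
move=> Uy h; have [_ _ h1 _ _] := tP; apply: fibre_incl_inj.
have Uu (w : fibre V y) : U (pr (incl w)) by rewrite pr_incl.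
have [u1 su] := h1 _ (Uu u); have [v1 sv] := h1 _ (Uu v).
rewrite -su -sv; congr s; rewrite [LHS]surjective_pairing [RHS]surjective_pairing.
by rewrite u1 v1 !pr_incl; congr pair; apply/rowP => a; exact: h.
Qed.

Lemma tcoord_smooth a : sfn (pr @^-1` U) (tcoord t a).
Proof.
have [_ [ts _] _ _ _] := tP.
have h := smooth_on_snd (mfd_ok V) (mfd_ok M) (fin_dim_rV r) triv_open_pr ts.
have /smooth_on_modelP h2 := h.
apply/sfnP; first exact: triv_open_pr.
move=> c cV k; apply: (@Ck_coord _ _ _ _ _ (fun y => (t (chart_inv c y)).2)).
  by apply: open_pre1 => //; exact: triv_open_pr.
by apply: h2 => //; [exact: mfd_ok|exact: triv_open_pr].
Qed.

Lemma tcoord_continuous a v : U (pr v) -> {for v, continuous (tcoord t a)}.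
Proof. by move=> Uv; exact: (sfn_continuous (tcoord_smooth a)). Qed.

(** Near [z0] the map [f] is [s] applied to the pair of its base point and its coordinates, so
    continuity of these suffices. [lift_smooth] rests on the same factorisation. *)
Lemma lift_continuous (T : topologicalType) (f : T -> V) (z0 : T) :
  U (pr (f z0)) -> {for z0, continuous (pr \o f)} ->
  (forall a, {for z0, continuous (fun z => tcoord t a (f z))}) ->
  {for z0, continuous f}.
Proof.
move=> Uz0 c1 c2; have [_ [_ [sc _]] h1 h2 _] := tP.
have Uz : \forall z \near z0, U (pr (f z)).
  by apply: c1; apply: open_nbhs_nbhs; split=> //; exact: triv_open.
pose h z : TB := (pr (f z), \row_a tcoord t a (f z)).
have hE z : U (pr (f z)) -> h z = t (f z).
  move=> /h1[t1 _]; rewrite [RHS]surjective_pairing t1; congr pair.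
  by apply/rowP => a; rewrite mxE.
have hc : ((pr (f z), \row_a tcoord t a (f z)) : TB) @[z --> z0] --> h z0.
  refine (@cvg_pair _ _ _ (nbhs z0) (nbhs (pr (f z0))) (nbhs _) _ _ _
    (fun z => pr (f z)) (fun z => \row_a tcoord t a (f z)) c1 _).
  rewrite (_ : (fun z => \row_a _) = fun z => \sum_a tcoord t a (f z) *: 'e_a); last first.
    by apply/funext => z; rewrite [LHS]row_sum_coord; apply: eq_bigr => a _; rewrite mxE.
  rewrite (_ : (h z0).2 = \sum_a tcoord t a (f z0) *: 'e_a); last first.
    by rewrite [LHS]row_sum_coord; apply: eq_bigr => a _; rewrite mxE.
  apply: cvg_bigsum => a _; apply: cvgZr_tmp; exact: c2.
have fz0 : s (h z0) = f z0 by rewrite hE//; have [] := h1 _ Uz0.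
have shc : s (h z) @[z --> z0] --> f z0.
  rewrite -fz0; apply: (@continuous_comp _ _ _ h s) hc _.
  by apply: sc.
apply: cvg_trans shc; apply: near_eq_cvg.
by apply: filterS Uz => z Uz; rewrite hE//; have [] := h1 _ Uz.
Qed.

Lemma lift_smooth E (X : charted E) (W : set X) (f : X -> V) :
  charted_ok X -> open W -> (forall x, W x -> U (pr (f x))) ->
  smooth_on W (pr \o f) ->
  (forall a, smooth_on (N := model_charted R) W (tcoord t a \o f)) ->
  smooth_on W f.
Proof.
move=> okX oW WU s1 s2; have [_ [_ ss] h1 h2 _] := tP.
pose h z : TB := (pr (f z), \row_a tcoord t a (f z)).
have hE z : U (pr (f z)) -> h z = t (f z).
  move=> /h1[t1 _]; rewrite [RHS]surjective_pairing t1; congr pair.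
  by apply/rowP => a; rewrite mxE.
have hs : smooth_on W h.
  apply: smooth_on_pair => //; [exact: mfd_ok|exact/model_charted_ok/fin_dim_rV|].
  apply/smooth_on_modelP => // c cX k.
  have oc : open [set y | chart_cod c y /\ W (chart_inv c y)].
    by have [_ h' _] := okX; apply: open_chart_pre1 => //; exact: h'.
  apply: Ck_rV => // a.
  have /smooth_on_modelP h3 := s2 a.
  rewrite (_ : (fun x => _) = (tcoord t a \o f) \o chart_inv c).
    exact: h3.
  by apply/funext => y /=; rewrite mxE.
have shs : smooth_on W (s \o h).
  apply: (smooth_on_comp okX TB_ok (mfd_ok V) oW _ hs ss).
  by move=> x /WU Ux /=.
apply: (smooth_on_ext okX (mfd_ok V) oW _ shs) => x /[!inE] Wx /=.
by rewrite hE; [have [] := h1 _ (WU _ Wx)|exact: WU].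
Qed.

Lemma triv_section y a : U y -> pr (s (y, 'e_a)) = y /\
  forall b, tcoord t b (s (y, 'e_a)) = (a == b)%:R.
Proof.
move=> Uy; have [_ _ _ /(_ (y, 'e_a) Uy)[h1 h2] _] := tP; split=> // b.
by rewrite /tcoord h2 mxE eqxx eq_sym.
Qed.

Lemma triv_section_smooth a : smooth_on (M := M) (N := V) U (fun y => s (y, 'e_a)).
Proof.
have oU := triv_open; apply: (lift_smooth (mfd_ok M) oU).
- by move=> x Ux; have [->] := triv_section a Ux.
- apply: (smooth_on_ext (mfd_ok M) (mfd_ok M) oU _ (@smooth_on_id _ M _)).
  by move=> x /[!inE] Ux /=; have [->] := triv_section a Ux.
- move=> b; apply: (@sfn_ext _ _ _ (fun=> (a == b)%:R)) => //.
    by move=> x /[!inE] Ux /=; have [_ ->] := triv_section a Ux.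
  exact: sfn_cst.
Qed.

Lemma triv_expand x (v : V) : U x -> pr v = x ->
  fcoord x v = \sum_a tcoord t a v *: fcoord x (s (x, 'e_a)).
Proof.
move=> Ux vx; apply: triv_inj => // b.
rewrite (lin_sum (triv_linear Ux b)) fcoordK// (bigD1 b)//= big1 ?addr0.
  have [h1 h2] := triv_section b Ux; rewrite fcoordK// h2 eqxx.
  by rewrite /GRing.scale /= mulr1.
move=> a /negbTE ab; have [h1 h2] := triv_section a Ux.
by rewrite fcoordK// h2 ab /GRing.scale /= mulr0.
Qed.

End one_trivialization.
End bundle.

(** Locally finite sums are written with a cut-off depending on the point. This replaces it by a
    cut-off that is constant on a neighbourhood, where continuity and smoothness can be read off. *)
Lemma sum_tail (Z : zmodType) (F : nat -> Z) (n m : nat) :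
  (forall i, (n <= i)%N -> F i = 0) -> (forall i, (m <= i)%N -> F i = 0) ->
  \sum_(i < n) F i = \sum_(i < m) F i.
Proof.
wlog nm : n m / (n <= m)%N => [hw|] hn hm.
  by case/orP: (leq_total n m) => h; [|symmetry]; exact: hw.
rewrite (big_ord_widen _ F nm) [RHS](bigID (fun i : 'I_m => (i < n)%N))/=.
by rewrite [X in _ + X]big1 ?addr0// => i; rewrite -leqNgt => /hn.
Qed.

Section global_frame.
Context {R : realType} {M : manifold R} (V : vector_bundle M).
Local Notation pr := (@bundle_proj _ _ V).
Local Notation r := (bundle_rank V).
Local Notation incl := (@fibre_incl _ _ V _).

(** Both halves serve to truncate sums: those of [transport] through the sections, those of [fnorm]
    through the functionals. *)
Definition frame_null (lam : nat -> 'I_r -> V -> R) (e : nat -> 'I_r -> M -> V)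
    (y : M) (i : nat) := forall a,
  fcoord y (e i a y) = 0 /\ forall v, pr v = y -> lam i a v = 0.

(** A possibly overcomplete substitute for a basis, which a nontrivial bundle lacks globally. By
    [gf_sum], the functionals embed each fibre in a space of coefficients and the sections give a
    left inverse. The cut-off [nb] has no regularity in the point; local uniformity is in
    [gf_loc]. *)
Record global_frame (lam : nat -> 'I_r -> V -> R) (e : nat -> 'I_r -> M -> V)
    (nb : M -> nat) : Prop := GlobalFrame {
  gf_lam : forall i a, sfn setT (lam i a);
  gf_lin : forall i a x, linear ((fun u : fibre V x => lam i a (incl u)) : _ -> R^o);
  gf_e : forall i a, smooth (e i a);
  gf_pr : forall i a y, pr (e i a y) = y;
  gf_nb : forall y i, (nb y <= i)%N -> frame_null lam e y i;
  gf_loc : forall x, exists U N, [/\ open U, U x &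
    forall y i, (N <= i)%N -> U y -> frame_null lam e y i];
  gf_sum : forall v, \sum_(i < nb (pr v)) \sum_a
    lam i a v *: fcoord (pr v) (e i a (pr v)) = fcoord (pr v) v }.

Lemma global_frame_exists (x0 : M) : exists lam e nb, global_frame lam e nb.
Proof.
have [g [W [C [hg hW hloc hpos]]]] := smooth_partition x0
  (P := fun W => exists t s, trivialization (V := V) W t s)
  (fun x => let: ex_intro U (ex_intro t (ex_intro s (conj h Ux))) := trivialization_at V x in
    ex_intro _ U (And3 (triv_open h) Ux (ex_intro _ t (ex_intro _ s h)))).
have /choice[t ht] i : exists t, exists s, trivialization (V := V) (W i) t s.
  by have [_ h _ _ _] := hW i.
have {ht}/choice[s ts] i : exists s, trivialization (V := V) (W i) (t i) s by [].
have oW i : open (W i) by have [h _ _ _ _] := hW i.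
have oC i : open (~` C i) by have [_ _ + _ _] := hW i; exact: closed_openC.
have gC i x : ~ C i x -> g i x = 0 by have [_ _ _ _ h] := hW i; exact: h.
have gW i x : ~ W i x -> g i x = 0.
  by move=> nW; apply: gC => Cx; apply: nW; have [_ _ _ h _] := hW i; exact: h.
have gs i : sfn setT (g i) by have [] := hg i.
have /choice[nb hnb] x : exists N, forall i, (N <= i)%N -> g i x = 0.
  by have [U [N [_ Ux h]]] := hloc x; exists N => i Ni; exact: h.
(* Functionals and sections each carry one factor [g i] in order to extend by 0, so their products
   add up to the sum of squares [S]; dividing the functionals by it yields [gf_sum]. *)
pose S x := \sum_(i < nb x) g i x ^+ 2.
have SE x N : (forall i, (N <= i)%N -> g i x = 0) -> S x = \sum_(i < N) g i x ^+ 2.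
  move=> hN; apply: (sum_tail (F := fun i => g i x ^+ 2)) => i.
    by move=> /hnb ->; rewrite expr0n.
  by move=> /hN ->; rewrite expr0n.
have S0 x : S x != 0.
  have [i gi] := hpos x.
  have ni : (i < nb x)%N by rewrite ltnNge; apply/negP => /hnb gi0; rewrite gi0 ltxx in gi.
  rewrite gt_eqF// /S (bigD1 (Ordinal ni))//= ltr_wpDr ?exprn_gt0//.
  by apply: sumr_ge0 => j _; exact: sqr_ge0.
have Ss : sfn setT S.
  apply: smooth_on_local => x _; have [U [N [oU Ux h]]] := hloc x.
  exists U => //; apply: (@sfn_ext _ _ _ (fun y => \sum_(i < N) g i y * g i y)) => //.
    move=> y /[!inE] Uy; rewrite (SE _ N) => [|i Ni]; last exact: h.
    by apply: eq_bigr => i _; rewrite expr2.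
  apply: sfn_sum => // i _; have gU : sfn U (g i) by exact: smooth_on_sub (gs i).
  exact: sfnM.
have opr (A : set M) : open A -> open (pr @^-1` A).
  by move=> oA; apply: open_comp oA => v _; exact: pr_continuous.
have prs (A : set V) : smooth_on (M := V) (N := M) A pr.
  exact: smooth_on_sub (bundle_proj_smooth V).
pose lam i a (v : V) := g i (pr v) * tcoord (t i) a v * (S (pr v))^-1.
pose e i a y : V := incl (g i y *: fcoord y (s i (y, 'e_a)) : fibre V y).
have null y i : g i y = 0 -> frame_null lam e y i.
  move=> g0 a; split; first by rewrite inclK g0 scale0r.
  by move=> v vy; rewrite /lam vy g0 !mul0r.
exists lam, e, nb; split.
- move=> i a; apply: smooth_on_local => v _.
  have [Wv|nWv] := pselect (W i (pr v)).
    exists (pr @^-1` W i) => //.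
    have oWi := opr _ (oW i).
    apply: sfnM => //; last first.
      apply: sfnV => //.
      exact: (sfn_comp (W := setT) oWi (fun _ _ => I) (prs _) Ss).
    apply: sfnM => //; last exact: tcoord_smooth.
    exact: (sfn_comp (W := setT) oWi (fun _ _ => I) (prs _) (gs i)).
  exists (pr @^-1` (~` C i)).
    by move=> Cv; apply: nWv; have [_ _ _ h _] := hW i; exact: h.
  apply: (@sfn_ext _ _ _ (fun=> 0)); first exact: opr.
    by move=> w /[!inE] /= /gC gw; rewrite /lam gw !mul0r.
  exact/sfn_cst/opr.
- move=> i a x; have [Wx|nWx] := pselect (W i x).
    move=> k u v; rewrite /lam !pr_incl (triv_linear (ts i) Wx a).
    by rewrite /GRing.scale /=; ring.
  by move=> k u v; rewrite /lam !pr_incl gW// !mul0r scaler0 addr0.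
- move=> i a; apply: smooth_on_local => y0 _.
  have [U [t' [s' [tP Uy0]]]] := trivialization_at V y0.
  have [Wy0|nWy0] := pselect (W i y0).
    have oUW : open (U `&` W i) by apply: openI => //; exact: triv_open tP.
    exists (U `&` W i) => //.
    have s1 : smooth_on (M := M) (N := V) (U `&` W i) (fun y => s i (y, 'e_a)).
      exact: smooth_on_sub (triv_section_smooth (ts i) a).
    apply: (lift_smooth tP (mfd_ok M) oUW).
    + by move=> x [Ux _]; rewrite pr_incl.
    + rewrite (_ : _ \o _ = id); first exact: smooth_on_id.
      by apply/funext => y /=; rewrite pr_incl.
    + move=> b.
      have s2 : sfn (U `&` W i) (tcoord t' b \o (fun y => s i (y, 'e_a))).
        apply: (sfn_comp oUW _ s1 (tcoord_smooth tP b)).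
        by move=> x [Ux Wx] /=; have [->] := triv_section (ts i) a Wx.
      have s3 : sfn (U `&` W i) (g i) by exact: smooth_on_sub (gs i).
      apply: (sfn_ext oUW _ (sfnM oUW s3 s2)) => y /[!inE] -[Uy Wy] /=.
      have /(_ (g i y) (fcoord y (s i (y, 'e_a))) 0) := triv_linear tP Uy b.
      have := lin0 (triv_linear tP Uy b) => /= ->.
      rewrite !addr0 => ->; rewrite fcoordK//.
      by have [->] := triv_section (ts i) a Wy.
  have oUC : open (U `&` ~` C i) by apply: openI => //; exact: triv_open tP.
  exists (U `&` ~` C i).
    by split=> // Cy; apply: nWy0; have [_ _ _ h _] := hW i; exact: h.
  apply: (lift_smooth tP (mfd_ok M) oUC).
  + by move=> x [Ux _]; rewrite pr_incl.
  + rewrite (_ : _ \o _ = id); first exact: smooth_on_id.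
    by apply/funext => y /=; rewrite pr_incl.
  + move=> b; apply: (@sfn_ext _ _ _ (fun=> 0)) => //; last exact: sfn_cst.
    move=> y /[!inE] -[Uy /gC gy] /=; rewrite /e gy scale0r.
    by have := lin0 (triv_linear tP Uy b) => /= ->.
- by move=> i a y; rewrite pr_incl.
- by move=> y i /hnb; exact: null.
- move=> x; have [U [N [oU Ux h]]] := hloc x; exists U, N; split=> // y i Ni Uy.
  by apply: null; exact: h.
- move=> v; set x := pr v.
  have hi i : \sum_a lam i a v *: fcoord x (e i a x) =
      (g i x ^+ 2 / S x) *: fcoord x v.
    have [Wx|/gW gx] := pselect (W i x); last first.
      rewrite gx expr0n mul0r scale0r big1// => a _.
      by rewrite /lam gx !mul0r scale0r.
    rewrite [in RHS](triv_expand (ts i) Wx erefl).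
    rewrite scaler_sumr; apply: eq_bigr => a _.
    rewrite inclK !scalerA; congr (_ *: _); rewrite /lam -/x; ring.
  under eq_bigr => i _ do rewrite hi.
  rewrite -scaler_suml -mulr_suml -/(S x).
  by rewrite divff// scale1r.
Qed.

End global_frame.

(** * Norms on the fibres and linear maps between fibres, from a global frame *)

Section transport.
Context {R : realType} {M : manifold R} (V : vector_bundle M).
Local Notation pr := (@bundle_proj _ _ V).
Local Notation r := (bundle_rank V).
Local Notation incl := (@fibre_incl _ _ V _).

Lemma near_pr_open (Z : topologicalType) (f : Z -> V) z0 (U : set M) : open U ->
  {for z0, continuous f} -> U (pr (f z0)) -> \forall z \near z0, U (pr (f z)).
Proof.
move=> oU fc Uz; have : {for z0, continuous (pr \o f)}.
  by apply: continuous_comp; [exact: fc|exact: pr_continuous].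
by apply; exact: (open_nbhs_nbhs (conj oU Uz)).
Qed.

(** [hG] reduces the claim to vectors with unit coordinates in a trivialization. These form a
    compact sphere, so the neighbourhoods given for the single vectors over [x0] can be replaced by
    one that serves all vectors. *)
Lemma sphere_near (Z : topologicalType) (z0 : Z) (x0 : M) (G : Z -> V -> Prop) :
  (forall z x (u : fibre V x) c, c != 0 -> G z (incl u) -> G z (incl (c *: u))) ->
  (forall u : fibre V x0, u != 0 ->
     \forall z \near z0 & v \near (incl u : V), G z v) ->
  \forall z \near z0 & x \near x0, forall u : fibre V x, u != 0 -> G z (incl u).
Proof.
move=> hG hu; have [U [t [s [tP Ux0]]]] := trivialization_at V x0.
have [oU [_ [sc _]] h1 h2 h3] := tP.
pose K := [set w : 'rV[R]_r | `|w| = 1].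
have Kc : compact K.
  apply: bounded_closed_compact.
    exists 1; split=> // b b1 w /= ->; exact: ltW.
  rewrite (_ : K = Num.norm @^-1` [set 1])//.
  apply: (@closed_comp _ _ (@Num.norm _ 'rV[R]_r)); last exact: closed_eq.
  by move=> w _; exact: norm_continuous.
have near_K : \forall p \near (z0, x0), K `<=` (fun w => G p.1 (s (p.2, w))).
  have /compact_near_coveringP Kn := Kc.
  apply: (Kn _ (nbhs (z0, x0)) (fun p w => G p.1 (s (p.2, w)))) => w Kw.
  pose v := s (x0, w).
  have [pv tv] : pr v = x0 /\ t v = (x0, w) by exact: h2.
  have v0 : fcoord x0 v != 0.
    apply/negP => /eqP v0; have : t v = (x0, w) by [].
    have := lin0 (h3 _ Ux0); rewrite -v0 fcoordK// tv /= => w0.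
    by move: Kw; rewrite /K /= w0 normr0 => /eqP; rewrite eq_sym oner_eq0.
  have := hu _ v0; rewrite fcoordK// => -[[A B] [/= Az Bv] AB].
  have scw : {for (x0, w), continuous s} by exact: sc.
  have [[X W] [/= Xx Ww] XW] := scw _ Bv.
  exists (W, A `*` X); first by split=> //=; exists (A, X).
  move=> [w' [z x]] [/= Ww' [Az' Xx']]; apply: (AB (z, _)); split=> //=.
  exact: (XW (x, w')).
have near_U : \forall p \near (z0, x0), U p.2.
  exists (setT, U); last by case=> z x [].
  by split=> /=; [exact: filterT|exact: (open_nbhs_nbhs (conj oU Ux0))].
near=> p => u u0.
have KG : K `<=` (fun w => G p.1 (s (p.2, w))) by near: p.
have Up : U p.2 by near: p.
set w := (t (incl u)).2.
have [tu su] := h1 (incl u) ltac:(by rewrite pr_incl).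
have w0 : w != 0.
  apply: contra_neq u0 => w0; apply: (triv_inj tP Up) => a.
  rewrite /tcoord -/w w0; have := lin0 (h3 _ Up) => /= ->; exact: erefl.
have nw : `|w|^-1 != 0 by rewrite invr_eq0 normr_eq0.
have := KG (`|w|^-1 *: w); rewrite /K /= normrZ normfV normr_id mulVf ?normr_eq0//.
move=> /(_ erefl) => Gw.
(* Rescale to the unit sphere, where [Gw] applies. *)
have -> : u = `|w| *: (`|w|^-1 *: u) by rewrite scalerA mulfV ?normr_eq0// scale1r.
apply: hG; first by rewrite normr_eq0.
suff -> : incl (`|w|^-1 *: u) = s (p.2, `|w|^-1 *: w) by [].
have [_ <-] := h1 (incl (`|w|^-1 *: u)) ltac:(by rewrite pr_incl).
congr s; rewrite [LHS]surjective_pairing.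
have [-> _] := h1 (incl (`|w|^-1 *: u)) ltac:(by rewrite pr_incl).
rewrite pr_incl; congr pair.
have := h3 _ Up `|w|^-1 u 0; have := lin0 (h3 _ Up) => /= ->.
by rewrite !addr0.
Unshelve. all: by end_near. Qed.

Context (lam : nat -> 'I_r -> V -> R) (e : nat -> 'I_r -> M -> V) (nb : M -> nat).
Hypothesis gf : global_frame lam e nb.

(** The l^1 norm of the frame coefficients. It is definite because [gf_sum] recovers a vector from
    them. *)
Definition fnorm x (u : fibre V x) : R := \sum_(i < nb x) \sum_a `|lam i a (incl u)|.

Lemma fnormE x (u : fibre V x) N : (forall i, (N <= i)%N -> frame_null lam e x i) ->
  fnorm u = \sum_(i < N) \sum_a `|lam i a (incl u)|.
Proof.
move=> hN; apply: (sum_tail (F := fun i => \sum_a `|lam i a (incl u)|)) => i.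
  by move=> /(gf_nb gf) h; apply: big1 => a _; have [_ ->] := h a; rewrite ?normr0 ?pr_incl.
by move=> /hN h; apply: big1 => a _; have [_ ->] := h a; rewrite ?normr0 ?pr_incl.
Qed.

Lemma fnorm_ge0 x (u : fibre V x) : 0 <= fnorm u.
Proof. by apply: sumr_ge0 => i _; apply: sumr_ge0. Qed.

Lemma lamD x (u v : fibre V x) i a :
  lam i a (incl (u + v)) = lam i a (incl u) + lam i a (incl v).
Proof.
by have := gf_lin gf i a 1 u v; rewrite !scale1r.
Qed.

Lemma lam0 x i a : lam i a (incl (0 : fibre V x)) = 0.
Proof. exact: (lin0 (gf_lin gf i a (x := x))). Qed.

Lemma lamZ x (u : fibre V x) k i a :
  lam i a (incl (k *: u)) = k * lam i a (incl u).
Proof. by have := gf_lin gf i a k u 0; rewrite /= lam0 !addr0. Qed.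

Lemma lamN x (u : fibre V x) i a : lam i a (incl (- u)) = - lam i a (incl u).
Proof. by rewrite -scaleN1r lamZ mulN1r. Qed.

Lemma frame_sum v y : pr v = y ->
  \sum_(i < nb y) \sum_a lam i a v *: fcoord y (e i a y) = fcoord y v.
Proof. by move=> <-; exact: gf_sum gf v. Qed.

Lemma ler_fnormD x (u v : fibre V x) : fnorm (u + v) <= fnorm u + fnorm v.
Proof.
rewrite /fnorm -big_split /=; apply: ler_sum => i _.
rewrite -big_split /=; apply: ler_sum => a _.
by rewrite lamD ler_normD.
Qed.

Lemma fnormZ x (u : fibre V x) k : fnorm (k *: u) = `|k| * fnorm u.
Proof.
rewrite /fnorm mulr_sumr; apply: eq_bigr => i _; rewrite mulr_sumr.
by apply: eq_bigr => a _; rewrite lamZ normrM.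
Qed.

Lemma fnorm_gt0 x (u : fibre V x) : u != 0 -> 0 < fnorm u.
Proof.
move=> u0; rewrite lt_neqAle fnorm_ge0 andbT eq_sym; apply: contra_neq u0 => n0.
have l0 i a : (i < nb x)%N -> lam i a (incl u) = 0.
  move=> ix; apply/eqP; rewrite -normr_eq0.
  have := n0; move/eqP; rewrite psumr_eq0 => [/allP/(_ (Ordinal ix))|j _]; last first.
    by apply: sumr_ge0.
  rewrite mem_index_enum => /(_ isT) /=; rewrite psumr_eq0// => /allP/(_ a).
  by rewrite mem_index_enum; exact.
rewrite -(inclK u) -(frame_sum (pr_incl u)).
by apply: big1 => i _; apply: big1 => a _; rewrite l0// scale0r.
Qed.

Lemma fnorm0 x : fnorm (0 : fibre V x) = 0.
Proof. by apply: big1 => i _; apply: big1 => a _; rewrite lam0 normr0. Qed.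

(** The scalar [c] lets one statement cover both uses: [c = 0] gives continuity of the norm, [c = 1]
    that of a distance. *)
Lemma fnorm_sub_continuous (Z : topologicalType) (y : Z -> M) (f g : Z -> V)
    (c : R) (z0 : Z) :
  (forall z, pr (f z) = y z) -> (forall z, pr (g z) = y z) ->
  {for z0, continuous f} -> {for z0, continuous g} ->
  {for z0, continuous (fun z => fnorm (fcoord (y z) (f z) - c *: fcoord (y z) (g z)))}.
Proof.
move=> fy gy fc gc; have [U [N [oU Ux hN]]] := gf_loc gf (pr (f z0)).
apply: (@continuous_near _ _ (fun z => \sum_(i < N) \sum_a
    `|lam i a (f z) - c * lam i a (g z)|)).
  near=> z.
  have Uz : U (y z) by rewrite -fy; near: z; exact: near_pr_open.
  rewrite (@fnormE _ _ N); last by move=> i Ni; exact: hN.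
  apply: eq_bigr => i _; apply: eq_bigr => a _.
  by rewrite lamD lamN lamZ !fcoordK.
apply: cvg_bigsum => i _; apply: cvg_bigsum => a _; apply: cvg_norm.
have lc v : {for v, continuous (lam i a)} by exact: (sfn_continuous (gf_lam gf i a)).
apply: cvgB; first exact: (@continuous_comp _ _ _ f (lam i a) _ fc (lc _)).
apply: cvgM; first exact: cvg_cst.
exact: (@continuous_comp _ _ _ g (lam i a) _ gc (lc _)).
Unshelve. all: by end_near. Qed.

Lemma fnorm_continuous (Z : topologicalType) (y : Z -> M) (f : Z -> V) (z0 : Z) :
  (forall z, pr (f z) = y z) -> {for z0, continuous f} ->
  {for z0, continuous (fun z => fnorm (fcoord (y z) (f z)))}.
Proof.
move=> fy fc; have := @fnorm_sub_continuous Z y f f 0 z0 fy fy fc fc.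
apply: continuous_near; apply: nearW => z.
by rewrite scale0r subr0.
Qed.

Definition transport (y : M) (v : V) : V :=
  incl (\sum_(i < nb y) \sum_a lam i a v *: fcoord y (e i a y) : fibre V y).

Lemma transportE y v N : (forall i, (N <= i)%N -> frame_null lam e y i) ->
  transport y v = incl (\sum_(i < N) \sum_a lam i a v *: fcoord y (e i a y) : fibre V y).
Proof.
move=> hN; rewrite /transport; congr fibre_incl.
apply: (sum_tail (F := fun i => \sum_a lam i a v *: fcoord y (e i a y))) => i.
  by move=> /(gf_nb gf) h; apply: big1 => a _; have [-> _] := h a; rewrite scaler0.
by move=> /hN h; apply: big1 => a _; have [-> _] := h a; rewrite scaler0.
Qed.

Lemma pr_transport y v : pr (transport y v) = y.
Proof. exact: pr_incl. Qed.

Lemma transport_id v : transport (pr v) v = v.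
Proof. by rewrite /transport (gf_sum gf) fcoordK. Qed.

Lemma transport_linear x y :
  linear (fun u : fibre V x => fcoord y (transport y (incl u))).
Proof.
move=> k u v; rewrite !inclK scaler_sumr -big_split; apply: eq_bigr => i _ /=.
rewrite scaler_sumr -big_split; apply: eq_bigr => a _ /=.
by rewrite lamD lamZ scalerDl scalerA.
Qed.

Lemma transport_continuous (Z : topologicalType) (f : Z -> M) (g : Z -> V) z0 :
  {for z0, continuous f} -> {for z0, continuous g} ->
  {for z0, continuous (fun z => transport (f z) (g z))}.
Proof.
move=> fc gc; have [U [t [s [tP Ux0]]]] := trivialization_at V (f z0).
apply: (lift_continuous tP); first by rewrite pr_transport.
  rewrite (_ : _ \o _ = f)//; apply/funext => z /=; exact: pr_transport.
move=> b; have [W [N [oW Wx hN]]] := gf_loc gf (f z0).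
apply: (@continuous_near _ _ (fun z => \sum_(i < N) \sum_a
    lam i a (g z) * tcoord t b (e i a (f z)))).
  near=> z.
  have Uz : U (f z) by near: z; apply: fc; exact: (open_nbhs_nbhs (conj (triv_open tP) Ux0)).
  have Wz : W (f z) by near: z; apply: fc; exact: (open_nbhs_nbhs (conj oW Wx)).
  rewrite (@transportE _ _ N); last by move=> i Ni; exact: hN.
  rewrite (lin_sum2 (triv_linear tP Uz b)).
  by apply: eq_bigr => i _; apply: eq_bigr => a _; rewrite fcoordK// (gf_pr gf).
apply: cvg_bigsum => i _; apply: cvg_bigsum => a _.
have lc v : {for v, continuous (lam i a)} by exact: (sfn_continuous (gf_lam gf i a)).
have ec y : {for y, continuous (e i a)} by have [h _] := gf_e gf i a; exact: h.
apply: cvgM; first exact: (@continuous_comp _ _ _ g (lam i a) _ gc (lc _)).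
apply: (@continuous_comp _ _ _ f (tcoord t b \o e i a) _ fc).
apply: continuous_comp; first exact: ec.
by apply: (tcoord_continuous tP); rewrite (gf_pr gf).
Unshelve. all: by end_near. Qed.

Definition injective_at y x :=
  forall u : fibre V x, u != 0 -> fcoord y (transport y (incl u)) != 0.

(** For [u] nonzero over [x0], the vector T_x0 u = u has positive norm, and the norm of T_y v is
    continuous in the pair (y, v). [sphere_near] makes the neighbourhood independent of [u]. *)
Lemma injective_near (x0 : M) : \forall y \near x0 & x \near x0, injective_at y x.
Proof.
have := @sphere_near M x0 x0 (fun y v => 0 < fnorm (fcoord y (transport y v))).
move=> H; near=> p.
  have : forall u : fibre V p.2, u != 0 -> 0 < fnorm (fcoord p.1 (transport p.1 (incl u))).
    near: p; apply: H.
      move=> y x u c c0 h.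
      have /= := transport_linear y c u 0.
      rewrite !addr0 (lin0 (@transport_linear x y)) addr0 => ->.
      by rewrite fnormZ mulr_gt0// normr_gt0.
    move=> u u0.
    have c1 : {for (x0, incl u : V), continuous (fun p : M * V =>
        fnorm (fcoord p.1 (transport p.1 p.2)))}.
      apply: fnorm_continuous; first by move=> z; exact: pr_transport.
      apply: transport_continuous.
        exact: cvg_fst.
      exact: cvg_snd.
    apply: (c1 [set k : R | 0 < k]); apply: open_nbhs_nbhs; split; first exact: open_gt.
    rewrite /= (_ : transport x0 (incl u) = incl u); last first.
      by rewrite -{1}(pr_incl u) transport_id.
    by rewrite inclK; exact: fnorm_gt0.
  move=> h u /h; apply: contraTneq => ->; by rewrite fnorm0 ltxx.
Unshelve. all: by end_near. Qed.

End transport.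

(** * Lifting a homotopy *)

Section lifting.
Context {R : realType} {M : manifold R} (V : vector_bundle M).
Local Notation pr := (@bundle_proj _ _ V).
Local Notation r := (bundle_rank V).
Local Notation incl := (@fibre_incl _ _ V _).

(** The base map is arbitrary, since the maps of the homotopy between its ends need not be
    diffeomorphisms; regularity of [A] is stated separately because it changes from continuous to
    smooth. *)
Record bundle_map (theta : M -> M) (A : V -> V) : Prop := BundleMap {
  bm_pr : forall v, pr (A v) = theta (pr v);
  bm_linear : forall x, linear (fun u : fibre V x => fcoord (theta x) (A (incl u)));
  bm_inj : forall x (u : fibre V x), u != 0 -> fcoord (theta x) (A (incl u)) != 0 }.

Context (lam : nat -> 'I_r -> V -> R) (e : nat -> 'I_r -> M -> V) (nb : M -> nat).
Hypothesis gf : global_frame lam e nb.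
Local Notation transport := (transport lam e nb).
Local Notation injective_at := (injective_at lam e nb).

Lemma bundle_map_transport theta theta' A : bundle_map theta A ->
  (forall x, injective_at (theta' x) (theta x)) ->
  bundle_map theta' (fun v => transport (theta' (pr v)) (A v)).
Proof.
move=> [hp hl hi] hinj.
have AE x (u : fibre V x) : A (incl u) = incl (fcoord (theta x) (A (incl u))).
  by rewrite fcoordK// hp pr_incl.
split=> [v|x k u v|x u u0]; first exact: pr_transport.
  rewrite !pr_incl (AE _ (k *: u + v)) hl (transport_linear gf).
  by rewrite -!AE.
by rewrite pr_incl AE; apply: hinj; exact: hi.
Qed.

(** Compactness of [0, 1] gives an admissible constant step near each point. A mean of these
    constants, weighted by a locally finite smooth family, is continuous and does not exceed all
    constants active at [x]. *)
Lemma step_size (H : M * R -> M) (x0 : M) : continuous H ->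
  exists eps : M -> R, [/\ continuous eps, forall x, 0 < eps x &
    forall x (s t : R), 0 <= s <= 1 -> `|s - t| <= eps x ->
      injective_at (H (x, t)) (H (x, s))].
Proof.
move=> Hc.
pose P (W : set M) := exists2 d : R, 0 < d & forall x (s t : R), W x -> 0 <= s <= 1 ->
  `|s - t| <= d -> injective_at (H (x, t)) (H (x, s)).
have hP x : exists W, [/\ open W, W x & P W].
  have /compact_near_coveringP Kn := @segment_compact R 0 1.
  (* The second component of the parameter, tending to 0, plays the role of the step length. *)
  have := Kn _ (nbhs (x, 0 : R)) (fun p s => forall t, `|s - t| <= `|p.2| ->
    injective_at (H (p.1, t)) (H (p.1, s))) _.
  case=> [s _|[A B] [/= Ax B0] AB].
    have [[N1 N2] [/= hN1 hN2] N12] := injective_near gf (H (x, s)).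
    have [[A B] [/= Ax Bs] AB] := Hc (x, s) _ (filterI hN1 hN2).
    have /nbhs_ballP[d /= d0 Bd] := Bs.
    (* Half for the distance from [s] to [s'] and half for the step, so that both times remain in
       [B]. *)
    exists (ball s (d / 2), (A `*` [set h | `|h| < d / 2])).
      split=> /=; first by apply: nbhsx_ballx; exact: divr_gt0.
      exists (A, [set h | `|h| < d / 2]) => //; split=> //=.
      by apply: (@nbhs0_lt R R); exact: divr_gt0.
    move=> [s' [x' h]] [/= s's [Ax' hd]] t s't.
    have tB : B t.
      apply: Bd; rewrite /ball /= in s's *.
      rewrite (_ : s - t = (s - s') + (s' - t)); last by rewrite addrA subrK.
      rewrite (splitr d) (le_lt_trans (ler_normD _ _))// ltrD//.
      exact: le_lt_trans s't hd.
    have sB : B s'.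
      by apply: Bd; apply: le_ball s's; rewrite ler_pdivrMr// ler_peMr// ?ler1n// ltW.
    have [Ht _] := AB (x', t) (conj Ax' tB).
    have [_ Hs] := AB (x', s') (conj Ax' sB).
    exact: (N12 (_, _) (conj Ht Hs)).
  have /nbhs_ballP[d /= d0 Bd] := B0.
  move: Ax; rewrite nbhsE => -[W [oW Wx] WA]; exists W; split=> //.
  exists (d / 2); first exact: divr_gt0.
  move=> y s t Wy s01 std.
  apply: (AB (y, d / 2)) => /=.
  - split=> /=; first exact: WA.
    apply: Bd; rewrite /ball /= sub0r normrN gtr0_norm ?divr_gt0//.
    by rewrite ltr_pdivrMr// ltr_pMr// ltr1n.
  - by rewrite in_itv.
  - by rewrite (gtr0_norm (divr_gt0 d0 _)).
have [g [W [C [hg hW hloc hpos]]]] := smooth_partition x0 hP.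
have /choice[d hd] i : exists d : R, 0 < d /\ forall x (s t : R), W i x -> 0 <= s <= 1 ->
    `|s - t| <= d -> injective_at (H (x, t)) (H (x, s)).
  by have [_ [d d0 h] _ _ _] := hW i; exists d.
have gW i x : 0 < g i x -> W i x.
  have [_ _ _ CW gC] := hW i => gi; apply: CW; apply: contrapT => /gC g0.
  by rewrite g0 ltxx in gi.
have g0 i x : 0 <= g i x by have [_ h] := hg i; exact: h.
have gc i x : {for x, continuous (g i)}.
  by have [h _] := hg i; exact: (sfn_continuous h).
have /choice[n hn] x : exists N, forall i, (N <= i)%N -> g i x = 0.
  by have [U [N [_ Ux h]]] := hloc x; exists N => i Ni; exact: h.
(* The mean is [D x / S x]; [S] is positive but need not be 1. *)
pose S x := \sum_(i < n x) g i x.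
pose D x := \sum_(i < n x) g i x * d i.
have SE x N : (forall i, (N <= i)%N -> g i x = 0) -> S x = \sum_(i < N) g i x.
  by move=> hN; exact: (sum_tail (F := fun i => g i x) (hn x) hN).
have DE x N : (forall i, (N <= i)%N -> g i x = 0) -> D x = \sum_(i < N) g i x * d i.
  by move=> hN; apply: (sum_tail (F := fun i => g i x * d i)) => i;
    [move=> /hn ->|move=> /hN ->]; rewrite mul0r.
have Spos x (f : nat -> R) :
    (forall i, 0 < g i x -> 0 < f i) -> 0 < \sum_(i < n x) g i x * f i.
  move=> f0; have [i gi] := hpos x.
  have ni : (i < n x)%N by rewrite ltnNge; apply/negP => /hn gi0; rewrite gi0 ltxx in gi.
  rewrite (bigD1 (Ordinal ni))//= ltr_wpDr ?mulr_gt0 ?f0//.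
  apply: sumr_ge0 => j _; have := g0 j x; rewrite le_eqVlt => /predU1P[<-|gj].
    by rewrite mul0r.
  by rewrite mulr_ge0// ltW// f0.
have S0 x : 0 < S x.
  have := Spos x (fun=> 1) (fun _ _ => ltr01).
  by under eq_bigr do rewrite mulr1.
have D0 x : 0 < D x by apply: Spos => i _; have [] := hd i.
exists (fun x => D x / S x); split.
- move=> x; have [U [N [oU Ux h]]] := hloc x.
  have nU : nbhs x U by apply: open_nbhs_nbhs.
  apply: cvgM.
    apply: (@continuous_near _ _ (fun y => \sum_(i < N) g i y * d i)).
      by apply: filterS nU => y Uy; rewrite (DE _ N)// => i Ni; exact: h.
    by apply: cvg_bigsum => i _; apply: cvgM; [exact: gc|exact: cvg_cst].
  apply: cvgV; first by rewrite gt_eqF.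
  apply: (@continuous_near _ _ (fun y => \sum_(i < N) g i y)).
    by apply: filterS nU => y Uy; rewrite (SE _ N)// => i Ni; exact: h.
  by apply: cvg_bigsum => i _; exact: gc.
- by move=> x; exact: divr_gt0.
- move=> x s t s01 st.
  (* The mean is at most [d i] for some active [i]: otherwise the weighted sum of the differences
     [D x / S x - d i] would be positive, yet it is 0. *)
  have [i [gi di]] : exists i, 0 < g i x /\ D x / S x <= d i.
    apply: contrapT => /forallNP hno.
    have : 0 < \sum_(i < n x) g i x * (D x / S x - d i).
      apply: (Spos x (fun i => D x / S x - d i)) => i gi; rewrite subr_gt0 ltNge.
      by apply/negP => di; exact: (hno i).
    under eq_bigr do rewrite mulrBr.
    rewrite sumrB -mulr_suml -/(S x) -/(D x) mulrCA mulfV ?gt_eqF// mulr1.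
    by rewrite subrr ltxx.
  have [_ h] := hd i; apply: h s01 _; first exact: gW.
  exact: le_trans st di.
Qed.

Lemma continuous_lift (H : M * R -> M) (x0 : M) (Phi : V -> V) : continuous H ->
  bundle_map (fun x => H (x, 0)) Phi -> continuous Phi ->
  exists2 A, bundle_map (fun x => H (x, 1)) A & continuous A.
Proof.
move=> Hc hPhi Phic; have [eps [ec e0 hinj]] := step_size x0 Hc.
(* The time reached over [x] after [k] steps, stopped at 1; consecutive times differ by at most
   [eps x]. *)
pose tk (k : nat) x := Order.min 1 (k%:R * eps x).
have tk01 k x : 0 <= tk k x <= 1.
  by rewrite /tk ge_min lexx /= le_min ler01 mulr_ge0// ltW.
have tkc k : continuous (tk k).
  move=> x.
  apply: (@continuous_min R M (fun=> 1) (fun x => k%:R * eps x)).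
    exact: cvg_cst.
  by apply: cvgM; [exact: cvg_cst|exact: ec].
pose A := fix A (k : nat) (v : V) {struct k} : V :=
  if k is k'.+1 then transport (H (pr v, tk k (pr v))) (A k' v) else Phi v.
have hA k : bundle_map (fun x => H (x, tk k x)) (A k).
  elim: k => [|k IH].
    rewrite (_ : (fun x => _) = (fun x => H (x, 0)))//.
    by apply/funext => x; rewrite /tk mul0r min_r.
  apply: (bundle_map_transport IH) => x; apply: hinj => //.
  have := e0 x; rewrite /tk -natr1 mulrDl mul1r.
  move: (k%:R * eps x) (eps x) => a b b0; rewrite ler_norml.
  by rewrite /Order.min; case: ltP => ha; case: ltP => hb; apply/andP; split; lra.
have Ac k : continuous (A k).
  elim: k => [//|k IH] v /=; apply: (transport_continuous gf); last exact: IH.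
  apply: (@continuous_comp _ _ _ (fun v => (pr v, tk k.+1 (pr v))) H); last exact: Hc.
  refine (@cvg_pair _ _ _ (nbhs v) (nbhs (pr v)) (nbhs _) _ _ _ pr
    (fun v => tk k.+1 (pr v)) (@pr_continuous _ _ V v) _).
  by apply: (@continuous_comp _ _ _ pr (tk k.+1)); [exact: pr_continuous|exact: tkc].
(* From time 1 on, each step transports a vector to the fibre where it already lies, which is the
   identity by [transport_id]. *)
have Ast k m v : 1 <= k%:R * eps (pr v) -> (k <= m)%N -> A m v = A k v.
  move=> k1; elim: m => [|m IH]; first by rewrite leqn0 => /eqP ->.
  rewrite leq_eqVlt => /orP[/eqP -> //|]; rewrite ltnS => km /=.
  have tk1 j : (k <= j)%N -> tk j (pr v) = 1.
    move=> kj; rewrite /tk min_l// (le_trans k1)// ler_pM2r// ler_nat//.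
  have := transport_id gf (A m v); rewrite (bm_pr (hA m)) !tk1// ?(leq_trans km)// => ->.
  exact: IH.
have arch (d : R) : 0 < d -> exists k : nat, 1 <= k%:R * d.
  move=> d0; exists (Num.truncn d^-1).+1; rewrite -ler_pdivrMr// div1r ltW//.
  exact: truncnS_gt.
have /choice[n hn] x : exists k : nat, 1 <= k%:R * eps x by exact: arch.
exists (fun v => A (n (pr v)) v).
  have tk1 x : tk (n x) x = 1 by rewrite /tk min_l.
  split=> [v|x k u v|x u u0].
  - by rewrite (bm_pr (hA _)) tk1.
  - rewrite !pr_incl; have := bm_linear (hA (n x)) k u v; rewrite tk1; exact.
  - by rewrite !pr_incl; have := bm_inj (hA (n x)) u0; rewrite tk1.
(* The number [n (pr v)] may jump with [v]. Halving [eps] leaves room for it to vary near [v], so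
   that a single [k] suffices for all nearby vectors and the map agrees there with the continuous
   [A k]. *)
move=> v; have [k hk] := arch (eps (pr v) / 2) (divr_gt0 (e0 _) (ltr0Sn R 1)).
apply: (@continuous_near _ _ (A k)); last exact: Ac.
near=> w.
have hkw : 1 <= k%:R * eps (pr w).
  apply: (le_trans hk); rewrite ler_wpM2l//.
  near: w.
  have c1 : {for v, continuous (eps \o pr)}.
    by apply: continuous_comp; [exact: pr_continuous|exact: ec].
  apply: (c1 [set z | eps (pr v) / 2 <= z]).
  have half : eps (pr v) / 2 < eps (pr v) by rewrite ltr_pdivrMr// ltr_pMr// ltr1n.
  by apply: filterS (lt_nbhsr half) => z /ltW.
have [kn|nk] := leqP k (n (pr w)); first exact/esym/Ast.
by apply: Ast => //; exact: ltnW.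
Unshelve. all: by end_near. Qed.

End lifting.

(** * Smoothing and automorphisms *)

Section smoothing.
Context {R : realType} {M : manifold R} (V : vector_bundle M).
Local Notation pr := (@bundle_proj _ _ V).
Local Notation r := (bundle_rank V).
Local Notation incl := (@fibre_incl _ _ V _).

Context (lam : nat -> 'I_r -> V -> R) (e : nat -> 'I_r -> M -> V) (nb : M -> nat).
Hypothesis gf : global_frame lam e nb.
Local Notation tsp := (transport lam e nb).
Local Notation fnm := (fnorm lam nb).

Lemma ler_fnorm_sum x (n : nat) (u : 'I_n -> fibre V x) :
  fnm (\sum_i u i) <= \sum_i fnm (u i).
Proof.
elim/big_ind2 : _ => [|a b c d h1 h2|//]; first by rewrite (fnorm0 gf).
by apply: le_trans (ler_fnormD gf _ _) _; exact: lerD.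
Qed.

Context (theta : M -> M) (A : V -> V).
Hypotheses (theta_smooth : smooth theta) (hA : bundle_map theta A) (Ac : continuous A).

Definition frozen z v := tsp (theta (pr v)) (A (tsp z v)).

Lemma bm_inclE x (u : fibre V x) : A (incl u) = incl (fcoord (theta x) (A (incl u))).
Proof. by rewrite fcoordK// (bm_pr hA) pr_incl. Qed.

Lemma frozen_linear z x :
  linear (fun u : fibre V x => fcoord (theta x) (frozen z (incl u))).
Proof.
move=> k u v; rewrite /frozen !pr_incl.
have E (w : fibre V x) : tsp z (incl w) = incl (fcoord z (tsp z (incl w))).
  by rewrite fcoordK// pr_transport.
rewrite (E (k *: u + v)) (transport_linear gf) bm_inclE (bm_linear hA).
by rewrite (transport_linear gf) -!bm_inclE -!E.
Qed.

Lemma theta_continuous : continuous theta.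
Proof. by move=> x; have [h _] := theta_smooth; exact: h. Qed.

Lemma frozen_continuous z : continuous (frozen z).
Proof.
move=> v; apply: (transport_continuous gf).
  by apply: continuous_comp; [exact: pr_continuous|exact: theta_continuous].
apply: (@continuous_comp _ _ _ (tsp z) A); last exact: Ac.
by apply: (transport_continuous gf); [exact: cvg_cst|exact: cvg_id].
Qed.

Definition frozen_close z x := forall u : fibre V x, u != 0 ->
  fnm (fcoord (theta x) (A (incl u)) - fcoord (theta x) (frozen z (incl u)))
  < fnm (fcoord (theta x) (A (incl u))).

(** Over [z] itself both transports are identities and [frozen z] agrees with [A], so the inequality
    only says that [A u] is nonzero; by continuity and [sphere_near] it persists nearby. *)
Lemma frozen_close_near (z : M) : \forall x \near z, frozen_close z x.
Proof.
pose G (_ : M) v := fnm (fcoord (theta (pr v)) (A v) -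
    fcoord (theta (pr v)) (frozen z v)) < fnm (fcoord (theta (pr v)) (A v)).
have : \forall z' \near z & x \near z, forall u : fibre V x, u != 0 -> G z' (incl u).
  apply: (@sphere_near _ _ V M z z G) => [z' x u c c0|u u0].
    rewrite /G !pr_incl.
    have := frozen_linear z c u 0; have := bm_linear hA c u 0.
    rewrite !addr0 (lin0 (@frozen_linear z x)) (lin0 (bm_linear hA (x := x))) !addr0.
    move=> -> ->; rewrite -scalerBr !(fnormZ gf) => h.
    by rewrite ltr_pM2l// normr_gt0.
  (* The factor 1 fits the form of [fnorm_sub_continuous]. *)
  pose F v := fnm (fcoord (theta (pr v)) (A v)) - fnm (fcoord (theta (pr v)) (A v) -
    1 *: fcoord (theta (pr v)) (frozen z v)).
  have hf v : pr (frozen z v) = theta (pr v) by exact: pr_transport.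
  have Fc : continuous F.
    move=> v; apply: cvgB.
      by apply: (fnorm_continuous gf) => [w|]; [exact: (bm_pr hA)|exact: Ac].
    apply: (fnorm_sub_continuous gf) => //; first exact: (bm_pr hA).
      exact: Ac.
    exact: frozen_continuous.
  have F0 : 0 < F (incl u).
    rewrite /F /frozen pr_incl (_ : tsp z (incl u) = incl u); last first.
      by rewrite -{1}(pr_incl u) (transport_id gf).
    rewrite (_ : tsp (theta z) (A (incl u)) = A (incl u)); last first.
      by have := transport_id gf (A (incl u)); rewrite (bm_pr hA) pr_incl.
    rewrite scale1r subrr (fnorm0 gf) subr0; apply: (fnorm_gt0 gf).
    exact: (bm_inj hA).
  have FN : \forall v \near (incl u : V), 0 < F v.
    by apply: (Fc _ [set k | 0 < k]); apply: open_nbhs_nbhs; split; [exact: open_gt|].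
  near=> p; rewrite /G /= -subr_gt0.
  have -> : fnm (fcoord (theta (pr p.2)) (A p.2)) -
     fnm (fcoord (theta (pr p.2)) (A p.2) - fcoord (theta (pr p.2)) (frozen z p.2)) = F p.2.
    by rewrite /F scale1r.
  by near: p; exact: (cvg_snd FN).
case=> -[X Y] [/= Xz Yz] XY; apply: filterS Yz => x Yx u u0.
have := XY (z, x) (conj (nbhs_singleton Xz) Yx) u u0.
by rewrite /G pr_incl.
Unshelve. all: by end_near. Qed.

(** By linearity of [A] on the fibre over [z], only the fixed vectors [A (e i a z)] enter, as
    constants multiplying the smooth functions [lam i a]. *)
Lemma frozen_coord_smooth z j b : sfn setT (fun v => lam j b (A (tsp z v))).
Proof.
have oT : open [set: V] by exact: openT.
rewrite (_ : (fun v => _) = fun v => \sum_(i < nb z) \sum_a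
  lam i a v * lam j b (A (e i a z))).
  apply: sfn_sum => // i _; apply: sfn_sum => // a _; apply: sfnM => //.
    exact: (gf_lam gf).
  exact: sfn_cst.
apply/funext => v.
have L : linear ((fun u : fibre V z => lam j b (A (incl u))) : _ -> R^o).
  move=> k u w; rewrite bm_inclE (bm_linear hA) (gf_lin gf).
  by rewrite -!bm_inclE.
rewrite /transport (lin_sum2 L).
by apply: eq_bigr => i _; apply: eq_bigr => a _; rewrite fcoordK// (gf_pr gf).
Qed.

Lemma smoothing (x0 : M) : exists2 B, bundle_map theta B & smooth (M := V) (N := V) B.
Proof.
pose P (W : set M) := exists z, forall x, W x -> frozen_close z x.
have hP x : exists W, [/\ open W, W x & P W].
  have : nbhs x (frozen_close x) by exact: frozen_close_near.
  rewrite nbhsE => -[W [oW Wx] hW].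
  by exists W; split=> //; exists x.
have [g [W [C [hg hW hloc hpos]]]] := smooth_partition x0 hP.
have /choice[z hz] i : exists z, forall x, W i x -> frozen_close z x.
  by have [_ h _ _ _] := hW i.
have gW i x : 0 < g i x -> W i x.
  have [_ _ _ CW gC] := hW i => gi; apply: CW; apply: contrapT => /gC g0.
  by rewrite g0 ltxx in gi.
have g0 i x : 0 <= g i x by have [_ h] := hg i; exact: h.
have gs i : sfn setT (g i) by have [] := hg i.
have /choice[n hn] x : exists N, forall i, (N <= i)%N -> g i x = 0.
  by have [U [N [_ Ux h]]] := hloc x; exists N => i Ni; exact: h.
pose B v : V := incl (\sum_(i < n (pr v)) g i (pr v) *:
  fcoord (theta (pr v)) (frozen (z i) v) : fibre V (theta (pr v))).
have prB v : pr (B v) = theta (pr v) by exact: pr_incl.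
exists B; first split=> //.
- move=> x k u v; rewrite /B !pr_incl !inclK scaler_sumr -big_split.
  apply: eq_bigr => i _ /=; rewrite frozen_linear scalerDr !scalerA.
  by rewrite (mulrC k).
- move=> x u u0; apply/negP => /eqP; rewrite /B pr_incl inclK => B0.
  set Au := fcoord (theta x) (A (incl u)).
  have hlt i : 0 < g i x ->
      fnm (Au - fcoord (theta x) (frozen (z i) (incl u))) < fnm Au.
    by move=> /gW/hz; exact.
  (* If the average kills [u], this identity holds, and its right side has norm strictly below that
     of its left side, since every active [i] satisfies the strict inequality [hlt] and at least one
     is active. *)
  have : (\sum_(i < n x) g i x) *: Au =
      \sum_(i < n x) g i x *: (Au - fcoord (theta x) (frozen (z i) (incl u))).
    under [RHS]eq_bigr do rewrite scalerBr.
    by rewrite sumrB B0 subr0 scaler_suml.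
  move=> /(congr1 (@fnorm _ _ _ lam nb (theta x))) E.
  have : fnm ((\sum_(i < n x) g i x) *: Au) <
      \sum_(i < n x) g i x * fnm Au.
    rewrite E; apply: le_lt_trans (ler_fnorm_sum _) _.
    have [i gi] := hpos x.
    have ni : (i < n x)%N by rewrite ltnNge; apply/negP => /hn gi0; rewrite gi0 ltxx in gi.
    rewrite (bigD1 (Ordinal ni))//= [ltRHS](bigD1 (Ordinal ni))//=.
    apply: ltr_leD.
      by rewrite (fnormZ gf) ger0_norm// ltr_pM2l// hlt.
    apply: ler_sum => j _; rewrite (fnormZ gf) ger0_norm//.
    have := g0 j x; rewrite le_eqVlt => /predU1P[<-|gj]; first by rewrite !mul0r.
    by rewrite ler_wpM2l// ltW// hlt.
  rewrite (fnormZ gf) ger0_norm; last by apply: sumr_ge0.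
  by rewrite mulr_suml ltxx.
- apply: smooth_on_local => v0 _.
  have [U [t [s [tP Uv]]]] := trivialization_at V (theta (pr v0)).
  (* Two separate cut-offs: [N1] for the weights near [pr v0], [N2] for the frame near its image
     under [theta]. *)
  have [U1 [N1 [oU1 U1v h1]]] := hloc (pr v0).
  have [U2 [N2 [oU2 U2v h2]]] := gf_loc gf (theta (pr v0)).
  have ths (S : set V) : smooth_on (M := V) (N := M) S (theta \o pr).
    apply: (@smooth_on_sub _ _ _ _ _ _ setT) => //.
    apply: (smooth_on_comp (mfd_ok V) (mfd_ok M) (mfd_ok M) openT _
      (bundle_proj_smooth V) theta_smooth) => //.
  have thc : continuous (theta \o pr).
    by move=> v; apply: continuous_comp; [exact: pr_continuous|exact: theta_continuous].
  pose D := pr @^-1` U1 `&` (theta \o pr) @^-1` (U `&` U2).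
  have oD : open D.
    apply: openI; first by apply: open_comp oU1 => v _; exact: pr_continuous.
    apply: open_comp => [v _|]; first exact: thc.
    by apply: openI => //; exact: triv_open tP.
  exists D => //.
  apply: (lift_smooth tP (mfd_ok V) oD).
  + by move=> v [_ [Ux _]]; rewrite prB.
  + rewrite (_ : _ \o _ = theta \o pr)//.
    by apply/funext => v /=; exact: prB.
  + move=> b.
    apply: (@sfn_ext _ _ _ (fun v => \sum_(i < N1) g i (pr v) *
       \sum_(j < N2) \sum_a lam j a (A (tsp (z i) v)) *
          tcoord t b (e j a (theta (pr v))))) => //.
      move=> v /[!inE] -[U1x [Ux U2x]] /=.
      have -> : B v = incl (\sum_(i < N1) g i (pr v) *:
          fcoord (theta (pr v)) (frozen (z i) v)).
        rewrite /B; congr fibre_incl.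
        apply: (sum_tail (F := fun i => g i (pr v) *:
          fcoord (theta (pr v)) (frozen (z i) v))) => i.
          by move=> /hn ->; rewrite scale0r.
        by move=> iN; rewrite h1// scale0r.
      rewrite (lin_sum (triv_linear tP Ux b)); apply: eq_bigr => i _.
      rewrite fcoordK; last by rewrite pr_transport.
      rewrite /frozen (@transportE _ _ _ _ _ _ gf (theta (pr v)) _ N2); last first.
        by move=> k Nk; exact: h2.
      rewrite (lin_sum2 (triv_linear tP Ux b)); congr (_ * _).
      apply: eq_bigr => j _; apply: eq_bigr => a _.
      by rewrite fcoordK// (gf_pr gf).
    apply: sfn_sum => // i _; apply: sfnM => //.
      apply: (sfn_comp (W := setT) oD _ _ (gs i)) => //.
      exact: smooth_on_sub (bundle_proj_smooth V).
    apply: sfn_sum => // j _; apply: sfn_sum => // a _; apply: sfnM => //.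
      exact: smooth_on_sub (frozen_coord_smooth (z i) j a).
    apply: (@sfn_comp _ V V D (pr @^-1` U) (e j a \o (theta \o pr)) (tcoord t b)) => //.
    + by move=> v [_ [Ux _]]; rewrite /= (gf_pr gf).
    + exact: (smooth_on_comp (mfd_ok V) (mfd_ok M) (mfd_ok V) oD (fun _ _ => I)
        (ths D) (gf_e gf j a)).
    + exact: (tcoord_smooth tP).
Qed.

End smoothing.

(** * Smoothness of determinants and inverse matrices *)

Section matrices.
Context {R : realType} {M : manifold R} (U : set M) (oU : open U).

Lemma sfn_det n (m : M -> 'M[R]_n) : (forall i j, sfn U (fun x => m x i j)) ->
  sfn U (fun x => \det (m x)).
Proof.
move=> hm; apply: sfn_sum => // p _; apply: sfnM => //; first exact: sfn_cst.
by apply: sfn_prod => // i _; exact: hm.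
Qed.

(** Cramer's rule: the entries are cofactors, polynomial in the entries of [m], divided by the
    determinant. *)
Lemma sfn_invmx n (m : M -> 'M[R]_n) i j : (forall i j, sfn U (fun x => m x i j)) ->
  (forall x, U x -> m x \in unitmx) -> sfn U (fun x => invmx (m x) i j).
Proof.
move=> hm um.
apply: (@sfn_ext _ _ _ (fun x => (\det (m x))^-1 * \adj (m x) i j)) => //.
  by move=> x /[!inE] Ux; rewrite /invmx um// [RHS]mxE.
apply: sfnM => //.
  apply: sfnV => //; last exact: sfn_det.
  by move=> x Ux; rewrite -unitfE -unitmxE; exact: um.
apply: (@sfn_ext _ _ _ (fun x => (-1) ^+ (j + i) * \det (row' j (col' i (m x))))) => //.
  by move=> x _; rewrite mxE.
apply: sfnM => //; first exact: sfn_cst.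
apply: sfn_det => k l; apply: (sfn_ext oU _ (hm (lift j k) (lift i l))).
by move=> x _; rewrite !mxE.
Qed.

End matrices.

(** * Smooth fibrewise injective maps over a diffeomorphism, and automorphisms *)

Section automorphisms.
Context {R : realType} {M : manifold R} (V : vector_bundle M).
Local Notation pr := (@bundle_proj _ _ V).
Local Notation r := (bundle_rank V).
Local Notation incl := (@fibre_incl _ _ V _).

Section bijection.
Context (theta theta' : M -> M) (B : V -> V).
Hypotheses (thetaK : cancel theta theta') (thetaK' : cancel theta' theta)
  (theta_smooth : smooth theta) (theta's : smooth theta')
  (hB : bundle_map theta B) (Bs : smooth (M := V) (N := V) B).

(** The local matrix of [B] in the row-vector convention: row [a] holds the coordinates of the image
    of the [a]-th local frame vector, and [B] acts by multiplication on the right. *)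
Definition bm_matrix (s : trivial_bundle M r -> V) (t' : V -> trivial_bundle M r)
  (x : M) : 'M[R]_r := \matrix_(a, b) tcoord t' b (B (s (x, 'e_a))).

Lemma bundle_map_injective : injective B.
Proof.
move=> v w Bvw; have prvw : pr v = pr w.
  by apply: (can_inj thetaK); rewrite -!(bm_pr hB) Bvw.
rewrite -(fcoordK (erefl (pr v))) -(fcoordK (esym prvw)); congr fibre_incl.
apply/eqP; rewrite -subr_eq0; apply: contrapT => /negP /(bm_inj hB).
have := bm_linear hB (-1) (fcoord (pr v) w) (fcoord (pr v) v).
rewrite !scaleN1r (addrC (- _)) => ->.
by rewrite !fcoordK// Bvw addNr eqxx.
Qed.

Lemma bm_matrixE U t s U' t' s' : trivialization (V := V) U t s ->
  trivialization (V := V) U' t' s' -> forall v, U (pr v) -> U' (theta (pr v)) ->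
  (t' (B v)).2 = (t v).2 *m bm_matrix s t' (pr v).
Proof.
move=> tP tP' v Uv Uv'; apply/rowP => b; rewrite !mxE.
have L : linear ((fun u : fibre V (pr v) => tcoord t' b (B (incl u))) : _ -> R^o).
  have E (u : fibre V (pr v)) : B (incl u) = incl (fcoord (theta (pr v)) (B (incl u))).
    by rewrite fcoordK// (bm_pr hB) pr_incl.
  move=> k u w; rewrite E (bm_linear hB) (triv_linear tP' Uv').
  by rewrite -!E.
rewrite -[LHS]/(tcoord t' b (B v)) -[in LHS](fcoordK (erefl (pr v))).
rewrite [in LHS](triv_expand tP Uv erefl) (lin_sum L).
apply: eq_bigr => a _; rewrite mxE fcoordK//.
by have [] := triv_section tP a Uv.
Qed.

(** Constant rank makes the matrix square, so a trivial kernel is enough; a row vector in the kernel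
    gives a vector with the same image under [B] as the zero vector. *)
Lemma bm_matrix_unit U t s U' t' s' : trivialization (V := V) U t s ->
  trivialization (V := V) U' t' s' -> forall x, U x -> U' (theta x) ->
  bm_matrix s t' x \in unitmx.
Proof.
move=> tP tP' x Ux Ux'; rewrite -row_free_unit -kermx_eq0; apply/rowV0P => u.
move=> /sub_kermxP u0; have [_ _ _ h2 _] := tP.
have E w : pr (s (x, w)) = x by have [] := h2 (x, w) Ux.
have T w : t (s (x, w)) = (x, w) by have [] := h2 (x, w) Ux.
have [_ _ h1' _ _] := tP'.
have BE w : B (s (x, w)) = s' (theta x, w *m bm_matrix s t' x).
  have pB : pr (B (s (x, w))) = theta x by rewrite (bm_pr hB) E.
  have [t1 <-] := h1' (B (s (x, w))) ltac:(by rewrite pB).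
  congr s'; rewrite [LHS]surjective_pairing t1 pB; congr pair.
  by rewrite (bm_matrixE tP tP') ?E// T.
have : s (x, u) = s (x, 0) by apply: bundle_map_injective; rewrite !BE u0 mul0mx.
by move=> /(congr1 t); rewrite !T => -[].
Qed.

(** The preimage is computed in trivializations with the inverse matrix. *)
Lemma bm_surj w : exists v, B v = w.
Proof.
have [U [t [s [tP Ux]]]] := trivialization_at V (theta' (pr w)).
have [U' [t' [s' [tP' Uy]]]] := trivialization_at V (pr w).
have um := bm_matrix_unit tP tP' Ux; rewrite thetaK' in um.
pose q : trivial_bundle M r :=
  (theta' (pr w), (t' w).2 *m invmx (bm_matrix s t' (theta' (pr w)))).
pose v := s q.
have [_ _ _ h2 _] := tP; have [pv tv] : pr v = theta' (pr w) /\ t v = q := h2 q Ux.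
have [_ _ h1' _ _] := tP'.
exists v; have pB : pr (B v) = pr w by rewrite (bm_pr hB) pv thetaK'.
have [t1 <-] := h1' (B v) ltac:(by rewrite pB).
have [t2 w2] := h1' w Uy; rewrite -[RHS]w2.
congr s'; rewrite [LHS]surjective_pairing [RHS]surjective_pairing t1 t2 pB; congr pair.
by rewrite (bm_matrixE tP tP') pv ?thetaK'// tv /= mulmxKV// um.
Qed.

Lemma bundle_map_AUT : AUT V B /\ hV V B = theta.
Proof.
have /choice[C BC] := bm_surj.
have CB : cancel B C by move=> v; apply: bundle_map_injective; exact: BC.
have prC w : pr (C w) = theta' (pr w).
  by apply: (can_inj thetaK); rewrite thetaK' -(bm_pr hB) BC.
split; last first.
  by apply/funext => x; rewrite /hV (bm_pr hB) pr_incl.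
split.
  exists C; split=> //.
  apply: smooth_on_local => w0 _.
  have [U [t [s [tP Ux]]]] := trivialization_at V (theta' (pr w0)).
  have [U' [t' [s' [tP' Uy]]]] := trivialization_at V (pr w0).
  have ths (S : set V) : smooth_on (M := V) (N := M) S (theta' \o pr).
    apply: (@smooth_on_sub _ _ _ _ _ _ setT) => //.
    exact: (smooth_on_comp (mfd_ok V) (mfd_ok M) (mfd_ok M) openT (fun _ _ => I)
      (bundle_proj_smooth V) theta's).
  have thc : continuous (theta' \o pr).
    by move=> v; have [h _] := ths setT; exact: h.
  have thc' : continuous theta.
    by move=> x; have [h _] := theta_smooth; exact: h.
  (* The set of base points where the matrix of [B] is defined and invertible; [D] consists of the
     vectors [w] for which [C w] lies over it. *)
  pose D0 := U `&` theta @^-1` U'.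
  have oD0 : open D0.
    apply: openI; first exact: triv_open tP.
    by apply: open_comp (triv_open tP') => x _; exact: thc'.
  pose D := (theta' \o pr) @^-1` D0.
  have oD : open D by apply: open_comp oD0 => v _; exact: thc.
  exists D; first by split=> //=; rewrite thetaK'.
  apply: (lift_smooth tP (mfd_ok V) oD).
  + by move=> v [Uv _]; rewrite prC.
  + rewrite (_ : _ \o _ = theta' \o pr)//.
    by apply/funext => v /=; exact: prC.
  + move=> a.
    (* The coordinates of [C w] are those of [w] times the inverse matrix at the base point of
       [C w], which is [theta' (pr w)]. *)
    apply: (@sfn_ext _ _ _ (fun w => \sum_b tcoord t' b w *
      invmx (bm_matrix s t' (theta' (pr w))) b a)) => //.
      move=> w /[!inE] -[/= Uw]; rewrite thetaK' => Uw'.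
      have := bm_matrixE tP tP' (v := C w); rewrite prC BC thetaK' => /(_ Uw Uw') tw.
      have um := bm_matrix_unit tP tP' Uw; rewrite thetaK' in um.
      rewrite /tcoord -[(t (C w)).2](mulmxK (um Uw')) -tw mxE.
      exact: erefl.
    apply: sfn_sum => // b _; apply: sfnM => //.
      apply: smooth_on_sub (tcoord_smooth tP' b).
      by move=> w [_ /=]; rewrite thetaK'.
    apply: (sfn_comp (W := D0) (f := fun x => invmx (bm_matrix s t' x) b a) oD) => //.
    apply: sfn_invmx => //; last first.
      by move=> x [Ux' Uy']; exact: bm_matrix_unit tP tP' _ Ux' Uy'.
    move=> i j.
    apply: (@sfn_ext _ _ _ (tcoord t' j \o (B \o (fun x => s (x, 'e_i))))) => //.
      by move=> x _; rewrite mxE.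
    apply: (@sfn_comp _ M V D0 (pr @^-1` U')) => //.
    + move=> x [Ux' Uy'] /=; rewrite (bm_pr hB).
      by have [->] := triv_section tP i Ux'.
    + apply: (smooth_on_comp (mfd_ok M) (mfd_ok V) (mfd_ok V) oD0 (fun _ _ => I) _ Bs).
      by apply: smooth_on_sub (triv_section_smooth tP i) => x [].
    + exact: tcoord_smooth tP' j.
move=> x; exists (theta x).
pose L (u : fibre V x) := fcoord (theta x) (B (incl u)).
pose LM := GRing.isLinear.Build _ _ _ _ L (bm_linear hB (x := x)).
pose Lf : {linear fibre V x -> fibre V (theta x)} := HB.pack L LM.
exists Lf; last by move=> u; rewrite /= /L fcoordK// (bm_pr hB) pr_incl.
exists (fun w => fcoord x (C (incl w))) => u /=.
  by rewrite /L fcoordK ?CB ?inclK// (bm_pr hB) pr_incl.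
by rewrite /L fcoordK ?BC ?inclK// prC pr_incl thetaK.
Qed.

End bijection.

Lemma AUT_bundle_map (Phi : V -> V) : AUT V Phi ->
  bundle_map (hV V Phi) Phi /\ continuous Phi.
Proof.
move=> [[Psi [_ _ [Pc _] _]] hPhi]; split; last by move=> v; exact: Pc.
have hx x : exists2 L : {linear fibre V x -> fibre V (hV V Phi x)},
    bijective L & forall u, Phi (incl u) = incl (L u).
  have [x' [L bL hL]] := hPhi x.
  (* [AUT] only asserts that some target fibre exists; the image of the zero vector identifies it as
     the one that [hV] names. *)
  have xx' : hV V Phi x = x' by rewrite /hV hL pr_incl.
  by rewrite xx'; exists L.
split=> [v|x|x u u0].
- have [L _ hL] := hx (pr v).
  by rewrite -{1}(fcoordK (erefl (pr v))) hL pr_incl.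
- have [L _ hL] := hx x => k u w.
  by rewrite !hL !inclK linearP.
- have [L bL hL] := hx x; rewrite hL inclK; apply: contra_neq u0 => Lu0.
  by apply: (bij_inj bL); rewrite Lu0 linear0.
Qed.

End automorphisms.

(** * Homotopies of the base and the lifting theorem *)

(* Precomposing with a retraction of [R] onto [0, 1] makes a homotopy continuous
   on all of [M * R]. *)
Lemma homotopic_global (R : realType) (M : manifold R) (f g : M -> M) :
  homotopic f g -> exists H : M * R -> M,
    [/\ continuous H, forall x, H (x, 0) = f x & forall x, H (x, 1) = g x].
Proof.
move=> [H [Hc H0 H1]].
pose c (p : M * R) : M * R := (p.1, Order.max 0 (Order.min 1 p.2)).
have c01 p : (setT `*` `[0, 1]) (c p).
  split=> //=; rewrite in_itv /= le_max lexx /= ge_max ler01 ge_min lexx//=.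
have cc : continuous c.
  move=> p.
  refine (@cvg_pair _ _ _ (nbhs p) (nbhs p.1) (nbhs _) _ _ _ fst
    (fun q => Order.max 0 (Order.min 1 q.2)) _ _); first exact: cvg_fst.
  apply: (@continuous_max R _ (fun=> 0) (fun q : M * R => Order.min 1 q.2)).
    exact: cvg_cst.
  apply: (@continuous_min R _ (fun=> 1) (fun q : M * R => q.2)).
    exact: cvg_cst.
  exact: cvg_snd.
exists (H \o c); split.
- move=> p; move/subspace_continuousP : Hc => /(_ _ (c01 p)) Hc.
  apply: cvg_trans Hc => S /=.
  move=> hS.
  (* Continuity of [H] is relative to the strip; as [c] takes all its values there, the side
     condition disappears after composition. *)
  have hS' : nbhs (c p) [set q | ([set: M] `*` `[0, 1]) q -> S (H q)] by exact: hS.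
  have : nbhs p [set q | ([set: M] `*` `[0, 1]) (c q) -> S (H (c q))] by exact: (cc p _ hS').
  by apply: filterS => q; apply; exact: c01.
- by move=> x; rewrite /= /c /= min_r// max_l.
- by move=> x; rewrite /= /c /= min_l// max_r.
Qed.

(** Extending the homotopy to all times first makes its reversal continuous by plain composition. *)
Lemma homotopic_sym (R : realType) (M : manifold R) (f g : M -> M) :
  homotopic f g -> homotopic g f.
Proof.
move=> /homotopic_global[H [Hc H0 H1]]; exists (fun p => H (p.1, 1 - p.2)); split.
- apply: continuous_subspaceT => p.
  apply: (@continuous_comp _ _ _ (fun q : M * R => (q.1, 1 - q.2)) H); last exact: Hc.
  refine (@cvg_pair _ _ _ (nbhs p) (nbhs p.1) (nbhs _) _ _ _ fst
    (fun q => 1 - q.2) _ _); first exact: cvg_fst.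
  by apply: cvgB; [exact: cvg_cst|exact: cvg_snd].
- by move=> x; rewrite /= subr0.
- by move=> x; rewrite /= subrr.
Qed.

Lemma liftable_homotopic (R : realType) (M : manifold R) (V : vector_bundle M)
    (phi psi : M -> M) : Diff M psi -> homotopic phi psi ->
  liftable V phi -> liftable V psi.
Proof.
move=> [psi' [psiK psiK' psis psi's]] /homotopic_global[H [Hc H0 H1]] hphi.
(* The empty space counts as connected. Over it any two maps agree; otherwise a point is at hand as
   the default value in [smooth_partition]. *)
have [[x0 _]|M0] := pselect (exists x : M, True); last first.
  rewrite (_ : psi = phi)//; apply/funext => x.
  by exfalso; apply: M0; exists x.
have [lam [e [nb gf]]] := global_frame_exists V x0.
have [Phi aPhi hPhi] := hphi.
have [bP cP] := AUT_bundle_map aPhi.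
have bP0 : bundle_map (fun x => H (x, 0)) Phi.
  by rewrite (_ : (fun x => _) = hV V Phi)// hPhi; apply/funext.
have [A hA cA] := continuous_lift gf x0 Hc bP0 cP.
have {}hA : bundle_map psi A.
  by rewrite (_ : psi = fun x => H (x, 1))//; apply/funext.
have [B hB sB] := smoothing gf psis hA cA x0.
by have [aB hBpsi] := bundle_map_AUT psiK psiK' psis psi's hB sB; exists B.
Qed.

Theorem corollary8 (R : realType) (M : manifold R) (V : vector_bundle M) :
  (forall phi psi : M -> M, Diff M phi -> Diff M psi -> homotopic phi psi ->
     (liftable V phi <-> liftable V psi)) /\
  ((forall phi : M -> M, Diff M phi ->
      exists psi : M -> M, [/\ Diff M psi, homotopic phi psi & liftable V psi]) ->
   set_surj (AUT V) (Diff M) (hV V)).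
Proof.
split=> [phi psi dphi dpsi h|hM phi dphi].
  by split; apply: liftable_homotopic => //; exact: homotopic_sym.
have [psi [dpsi h lpsi]] := hM _ dphi.
by have [Phi aPhi <-] := liftable_homotopic dphi (homotopic_sym h) lpsi; exists Phi.
Qed.
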